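(* Let $d,a,b,n\in\mathbb{N}^+$, let $\{\ ,\ \}$ be a regular Poisson bracket on $\mathbb{R}^d$, and let $(\mathbb{R}[(\mathbb{R}^d)^n][[\hbar]],\star)^{S_n}$ be the algebra of quantum symmetric functions on $(\mathbb{R}^d)^n$. Let $p=(p_1,\dots,p_a)\in\mathbb{R}[y_1,\dots,y_d]^a$ and $q=(q_1,\dots,q_b)\in\mathbb{R}[y_1,\dots,y_d]^b$, and let $\alpha\in\mathbb{N}^a$, $\beta\in\mathbb{N}^b$ satisfy $|\alpha|\le n$ and $|\beta|\le n$. Then $$e_\alpha(p)\star e_\beta(q)=\sum_{m=0}^\infty\Big(\sum_{\gamma\in \mathrm{Q}(\alpha,\beta,n,m)}e_\gamma(B(p,q))\Big)\hbar^m ,$$ where: (i) $B(p,q)=(p,q,\dots,B_k(p,q),\dots)$ is the family consisting of $p_1,\dots,p_a$, of $q_1,\dots,q_b$, and, for every $k\ge 0$, of $B_k(p,q)=(B_k(p_1,q_1),\dots,B_k(p_1,q_b),\dots,B_k(p_a,q_1),\dots,B_k(p_a,q_b))$; in $e_\gamma(B(p,q))$ the index $\gamma_{l00}$ corresponds to $p_l$, the index $\gamma_{0r0}$ to $q_r$, and the index $\gamma_{lrk}$ (with $l\in[a]$, $r\in[b]$, $k\ge0$) to $B_k(p_l,q_r)$. (ii) $\mathrm{Q}(\alpha,\beta,n,m)$ is the set of maps $\gamma:[0,a]\times[0,b]\times\mathbb{N}\to\mathbb{N}$, $(l,r,k)\mapsto\gamma_{lrk}$, such that: $\gamma_{00k}=0$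 for $k\ge 0$; if $l=0$ or $r=0$ then $\gamma_{lrk}=0$ for $k\ge 1$; $|\gamma|=\sum_{l=0}^a\sum_{r=0}^b\sum_{k=0}^\infty\gamma_{lrk}\le n$; $\sum_{l=0}^a\sum_{r=0}^b\sum_{k=0}^\infty k\gamma_{lrk}=m$; $\sum_{r=0}^b\sum_{k=0}^\infty\gamma_{lrk}=\alpha_l$ for $l\in[a]$; and $\sum_{l=0}^a\sum_{k=0}^\infty\gamma_{lrk}=\beta_r$ for $r\in[b]$.
   Context: Notation: $\mathbb{N}=\{0,1,2,\dots\}$, $[n]=\{1,\dots,n\}$, $[0,a]=\{0,1,\dots,a\}$, $|\alpha|=\sum_i\alpha_i$. Multi-symmetric functions. Points of $(\mathbb{R}^d)^n$ have coordinates $x_{ij}$, $i\in[n]$, $j\in[d]$, and $S_n$ acts by permuting the index $i$. For $f\in\mathbb{R}[y_1,\dots,y_d]$ and $i\in[n]$ put $f(i)=f(x_{i1},\dots,x_{id})$. For a finite or countable family $u=(u_s)_{s\in S}$ of polynomials in $\mathbb{R}[y_1,\dots,y_d]$ and a finitely supported $\delta:S\to\mathbb{N}$ with $|\delta|=\sum_s\delta_s\le n$, the polynomial $e_\delta(u)\in\mathbb{R}[(\mathbb{R}^d)^n]^{S_n}$ is defined by $\prod_{i=1}^n\big(1+\sum_{s\in S}u_s(i)t_s\big)=\sum_{|\delta|\le n}e_\delta(u)t^\delta$, with commuting formal variables $t_s$ and $t^\delta=\prod_s t_s^{\delta_s}$. Poisson structures. A Poisson bracket on $\mathbb{R}^N$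 is a bilinear antisymmetric bracket on $C^\infty(\mathbb{R}^N)$ satisfying the Leibniz and Jacobi identities; with coordinates $z_1,\dots,z_N$ it is regular if all $\pi_{ij}=\{z_i,z_j\}$ are polynomials. A regular Poisson bracket on $\mathbb{R}^d$ (coordinates $y_1,\dots,y_d$, $\pi_{ij}=\{y_i,y_j\}$) induces the product Poisson bracket on $(\mathbb{R}^d)^n$: $\{x_{ki},x_{lj}\}=\delta_{kl}\,\pi_{ij}(k)$. Star product. For a regular Poisson structure $\pi$ on $\mathbb{R}^N$, $\star$ is the Kontsevich star product on $\mathbb{R}[z_1,\dots,z_N][[\hbar]]$, $\mathbb{R}[[\hbar]]$-bilinear, normalized so that $f\star g=fg+\tfrac12\{f,g\}\hbar+O(\hbar^2)$. Write $f\star g=\sum_{k\ge0}B_k(f,g)\hbar^k$; thus $B_0(f,g)=fg$. Explicitly $B_k=\sum_{\Gamma\in\mathbb{G}_k}\frac{\omega_\Gamma}{k!}B_\Gamma$, where: $\mathbb{G}_k$ is the set of directed graphs with vertices $1,\dots,k,L,R$ and $2k$ edges such that each $v\in[k]$ is the source of exactly two ordered edges $e_v^1,e_v^2$, with distinct targets in $\{1,\dots,k,L,R\}\setminus\{v\}$, and no edges start at $L$ or $R$; $$B_\Gamma(f,g)=\sum_{I}\Big[\prod_{v=1}^k\Big(\prod_{e\to v}\partial_{I(e)}\Big)\pi_{I(e_v^1)I(e_v^2)}\Big]\Big(\prod_{e\to L}\partial_{I(e)}f\Big)\Big(\prod_{e\to R}\partial_{I(e)}g\Big),$$ the sum being over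 all maps $I$ from edges to $[N]$ (all derivatives attached to a vertex act on the single function at that vertex); and $$\omega_\Gamma=\frac{1}{2^k(2\pi)^{2k}}\int\bigwedge_{v=1}^k d\varphi_{e_v^1}\wedge d\varphi_{e_v^2},$$ (here $2\pi$ is the numerical constant) integrated over configurations of $k$ distinct points $z_1,\dots,z_k$ in the open upper half plane with its standard orientation, with $z_L=0$, $z_R=1$, and $\varphi_e=\arg\frac{z_w-z_v}{z_w-\overline{z_v}}$ for an edge $e$ from $v$ to $w$. In the expressions $B_k(p_l,q_r)$ the operators $B_k$ are those of the star product on $\mathbb{R}^d$; the product $\star$ of multi-symmetric functions is the star product on $(\mathbb{R}^d)^n$ with the product Poisson structure. $S_n$ acts on $(\mathbb{R}[(\mathbb{R}^d)^n][[\hbar]],\star)$ by algebra automorphisms, and the algebra of quantum symmetric functions is the subalgebra of invariants $(\mathbb{R}[(\mathbb{R}^d)^n][[\hbar]],\star)^{S_n}$. *)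

(* Defs.v *)
From HB Require Import structures.
From mathcomp Require Import all_boot all_order all_algebra finmap.
(* [monalg] (polynomials in arbitrarily many variables) is imported without its
   notations, which would shadow those of [mpoly]; [mpoly] has to come before
   mathcomp-analysis. *)
From mathcomp Require Import -(notations) monalg.
From mathcomp Require Import mpoly.
From mathcomp Require Import all_classical all_reals all_analysis.
From mathcomp Require Import complex ring lra.

Set Implicit Arguments.
Unset Strict Implicit.
Unset Printing Implicit Defensive.

Import Order.TTheory GRing.Theory Num.Theory.
Import numFieldNormedType.Exports.

Local Open Scope classical_set_scope.
Local Open Scope ring_scope.

Section Poisson.
Variables (R : realType) (N : nat).
Local Notation fct := ('rV[R]_N -> R).

(* [f] is of class C^m: all partial derivatives up to order [m] exist and are
   continuous. *)
Fixpoint Ck (m : nat) (f : fct) : Prop :=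
  if m is m'.+1 then
    continuous f /\
    forall i : 'I_N, (forall x, derivable f x (delta_mx 0 i)) /\
                     Ck m' ('D_(delta_mx 0 i) f)
  else continuous f.

Definition smooth (f : fct) : Prop := forall m, Ck m f.

(* The bracket is only constrained on smooth functions; linearity in the second
   argument follows from [pb_linear] and [pb_antisym]. *)
Record poisson_bracket (br : fct -> fct -> fct) : Prop := PoissonBracket {
  pb_smooth : forall f g, smooth f -> smooth g -> smooth (br f g);
  pb_linear : forall (c : R) f g h, smooth f -> smooth g -> smooth h ->
    br (c *: f + g) h = c *: br f h + br g h;
  pb_antisym : forall f g, smooth f -> smooth g -> br f g = - br g f;
  pb_leibniz : forall f g h, smooth f -> smooth g -> smooth h ->
    br f (g \* h) = br f g \* h + g \* br f h;
  pb_jacobi : forall f g h, smooth f -> smooth g -> smooth h ->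
    br f (br g h) + br g (br h f) + br h (br f g) = 0
}.

Definition coord (i : 'I_N) : fct := fun x => x 0 i.

(* A regular Poisson bracket, together with its matrix of structure polynomials
   [pi_ i j = {z_i, z_j}]. *)
Definition regular_poisson (br : fct -> fct -> fct)
    (pi_ : 'M[{mpoly R[N]}]_N) : Prop :=
  poisson_bracket br /\
  forall i j x, br (coord i) (coord j) x = (pi_ i j).@[fun l => x 0 l].

End Poisson.

(* [inl v] is the vertex [v], [inr false] is [L] and [inr true] is [R]. *)
Notation vertex k := ('I_k + bool)%type.

(* [(v, false)] is the edge e_v^1 and [(v, true)] is the edge e_v^2. *)
Notation edge k := ('I_k * bool)%type.

(* The source of an edge is part of its name, so a graph is the function giving
   the targets of the edges. *)
Notation graph k := {ffun edge k -> vertex k}.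

Definition admissible (k : nat) (G : graph k) : bool :=
  [forall v : 'I_k, [&& G (v, false) != G (v, true),
                        G (v, false) != inl v & G (v, true) != inl v]].

Section Weights.
Variable R : realType.

(* Differential of the argument along a curve [u] at time 0: the derivative of
   any local determination [theta] of [arg u].  By [dargE] it is well defined:
   d arg u = Im (du / u). *)
Definition darg (u : R -> R[i]) : R :=
  xget 0 [set c | exists theta : R -> R,
    (\forall t \near (0 : R),
       u t = `|u t| * (cos (theta t) +i* sin (theta t))%C) /\
    is_derive (0 : R) (1 : R) theta c].

Lemma polar1 (x y : R) : x ^+ 2 + y ^+ 2 = 1 -> exists t, cos t = x /\ sin t = y.
Proof.
move=> h.
have hx : -1 <= x <= 1 by apply/andP; split; nra.
have hxc : cos (acos x) = x by rewrite acosK // in_itv /=.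
have hs : sin (acos x) = `|y|.
  by rewrite sin_acos // -sqrtr_sqr; congr Num.sqrt; lra.
have [y0|y0] := leP 0 y.
  by exists (acos x); rewrite hs ger0_norm.
by exists (- acos x); rewrite cosN sinN hs ltr0_norm // opprK.
Qed.

Lemma dargE (u : R -> R[i]) (x y : R) : u 0 != 0 ->
  is_derive (0 : R) (1 : R) (fun t => complex.Re (u t)) x ->
  is_derive (0 : R) (1 : R) (fun t => complex.Im (u t)) y ->
  darg u = (complex.Re (u 0) * y - complex.Im (u 0) * x) /
           (complex.Re (u 0) ^+ 2 + complex.Im (u 0) ^+ 2).
Proof.
set a := fun t => complex.Re (u t); set b := fun t => complex.Im (u t).
move=> u0 da db.
have uE t : u t = (a t +i* b t)%C by rewrite /a /b; case: (u t).
have nE t : `|u t| = ((Num.sqrt (a t ^+ 2 + b t ^+ 2))%:C)%C by rewrite uE normc_def.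
have r0 : 0 < a 0 ^+ 2 + b 0 ^+ 2.
  rewrite lt0r addr_ge0 ?sqr_ge0 // andbT paddr_eq0 ?sqr_ge0 // !sqrf_eq0.
  apply: contra u0 => /andP[/eqP a0 /eqP b0].
  by rewrite uE a0 b0.
set c := (_ / _).
have U : [set c | exists theta : R -> R,
    (\forall t \near (0 : R),
       u t = `|u t| * (cos (theta t) +i* sin (theta t))%C) /\
    is_derive (0 : R) (1 : R) theta c] = [set c].
  apply/seteqP; split=> [c' /= [th [hth dth]]|_ /= ->].
    have hz : \forall t \near (0:R), a t * sin (th t) - b t * cos (th t) = 0.
      near=> t.
      have h : u t = `|u t| * (cos (th t) +i* sin (th t))%C by near: t.
      move: h; rewrite nE {1}uE => /eqP; rewrite eq_complex /= !mul0r subr0 addr0.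
      set n := Num.sqrt _; move: n => n.
      by move=> /andP[/eqP -> /eqP ->]; ring.
    have h0 := nbhs_singleton hth.
    move: h0; rewrite nE {1}uE => /eqP; rewrite eq_complex /= !mul0r subr0 addr0.
    set n := Num.sqrt _; move=> /andP[/eqP ha /eqP hb].
    have nn : n ^+ 2 = a 0 ^+ 2 + b 0 ^+ 2 by rewrite sqr_sqrtr // ltW.
    have d2 : is_derive (0:R) (1:R) (fun t => a t * sin (th t) - b t * cos (th t))
       (a 0 * (c' * cos (th 0)) + sin (th 0) * x -
        (b 0 * (c' * - sin (th 0)) + cos (th 0) * y)).
      have ds : is_derive (0:R) (1:R) (fun t => sin (th t)) (cos (th 0) * c').
        exact: (@is_derive1_comp _ sin th).
      have dc : is_derive (0:R) (1:R) (fun t => cos (th t)) (- sin (th 0) * c').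
        exact: (@is_derive1_comp _ cos th).
      have -> : (fun t => a t * sin (th t) - b t * cos (th t)) =
        a * (fun t => sin (th t)) - b * (fun t => cos (th t)) by [].
      apply: is_derive_eq.
      by rewrite /GRing.scale /=; ring.
    have d1 : is_derive (0:R) (1:R) (fun t => a t * sin (th t) - b t * cos (th t)) 0.
      have hz' : \forall t \near (0:R), cst (0:R) t = a t * sin (th t) - b t * cos (th t).
        by near=> t; rewrite /cst; apply/esym; near: t.
      have dc : is_derive (0:R) (1:R) (cst (0:R)) 0 by exact: is_derive_cst.
      exact: (@near_eq_is_derive _ _ _ _ _ _ _ _ hz' dc).
    have : a 0 * (c' * cos (th 0)) + sin (th 0) * x -
           (b 0 * (c' * - sin (th 0)) + cos (th 0) * y) = 0.
      have e1 := @derive_val _ _ _ _ _ _ _ d1; have e2 := @derive_val _ _ _ _ _ _ _ d2.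
      by rewrite -e2 e1.
    move=> /(congr1 ( *%R n)); rewrite mulr0 => h.
    have {}h : c' * (a 0 ^+ 2 + b 0 ^+ 2) = a 0 * y - b 0 * x.
      have : a 0 * c' * (n * cos (th 0)) + n * sin (th 0) * x +
        b 0 * c' * (n * sin (th 0)) - n * cos (th 0) * y = 0 by apply: etrans h; ring.
      by rewrite -ha -hb => e; apply: subr0_eq; apply: etrans e; ring.
    by rewrite /c -/(a 0) -/(b 0) -h mulfK // gt_eqF.
  have n0 : 0 < Num.sqrt (a 0 ^+ 2 + b 0 ^+ 2) by rewrite sqrtr_gt0.
  set n := Num.sqrt _ in n0.
  have nn : n ^+ 2 = a 0 ^+ 2 + b 0 ^+ 2 by rewrite sqr_sqrtr // ltW.
  have [t0 [ct0 st0]] : exists t, cos t = a 0 / n /\ sin t = b 0 / n.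
    by apply: polar1; rewrite !expr_div_n -mulrDl -nn divff // expf_neq0 // gt_eqF.
  pose V t := a t * a 0 + b t * b 0.
  pose W t := b t * a 0 - a t * b 0.
  exists (fun t => t0 + atan (W t / V t)); split.
    have dV : is_derive (0:R) (1:R) V (a 0 * x + b 0 * y).
      have -> : V = a * cst (a 0) + b * cst (b 0) by [].
      apply: is_derive_eq.
      by rewrite /GRing.scale /=; ring.
    have V0 : 0 < V 0 by rewrite /V -!expr2.
    have cV : {for 0, continuous V}.
      by apply/differentiable_continuous/derivable1_diffP; case: dV.
    near=> t.
    have Vt : 0 < V t by near: t; exact: (cvgr_gt _ cV).
    have VW : V t ^+ 2 + W t ^+ 2 = (a t ^+ 2 + b t ^+ 2) * n ^+ 2.
      by rewrite nn /V /W; ring.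
    have m0 : 0 <= a t ^+ 2 + b t ^+ 2 by rewrite addr_ge0 ?sqr_ge0.
    have hc : cos (atan (W t / V t)) = V t / (Num.sqrt (a t ^+ 2 + b t ^+ 2) * n).
      rewrite cos_atan -[RHS]invf_div; congr (_^-1).
      rewrite -[RHS]ger0_norm ?divr_ge0 ?mulr_ge0 ?sqrtr_ge0 ?ltW // -sqrtr_sqr.
      congr Num.sqrt; rewrite !expr_div_n exprMn sqr_sqrtr // -VW.
      by rewrite mulrDl divff // expf_neq0 // gt_eqF.
    have hs : sin (atan (W t / V t)) = cos (atan (W t / V t)) * (W t / V t).
      have cn : cos (atan (W t / V t)) != 0.
        rewrite cos_atan invr_neq0 // gt_eqF // sqrtr_gt0.
        by rewrite ltr_pwDl // sqr_ge0.
      have := atanK (W t / V t); rewrite /tan => e.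
      by rewrite -[LHS](divfK cn) e mulrC.
    rewrite nE {1}uE; apply/eqP; rewrite eq_complex /= !mul0r subr0 addr0.
    rewrite cosD sinD hs hc ct0 st0.
    have m1 : 0 < a t ^+ 2 + b t ^+ 2.
      have : 0 < V t ^+ 2 + W t ^+ 2 by rewrite ltr_pwDl ?exprn_gt0 ?sqr_ge0.
      by rewrite VW pmulr_lgt0 // exprn_gt0.
    have n1 : n != 0 by rewrite gt_eqF.
    have V1 : V t != 0 by rewrite gt_eqF.
    set m := Num.sqrt _.
    have m2 : m != 0 by rewrite gt_eqF // sqrtr_gt0.
    have e1 : a t * n ^+ 2 = a 0 * V t - b 0 * W t by rewrite nn /V /W; ring.
    have e2 : b t * n ^+ 2 = b 0 * V t + a 0 * W t by rewrite nn /V /W; ring.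
    apply/andP; split; apply/eqP; apply: (mulIf (expf_neq0 2 n1)).
      by rewrite e1; field; rewrite V1 n1 m2.
    by rewrite e2; field; rewrite V1 n1 m2.
  have dV : is_derive (0:R) (1:R) V (a 0 * x + b 0 * y).
    have -> : V = a * cst (a 0) + b * cst (b 0) by [].
    apply: is_derive_eq.
    by rewrite /GRing.scale /=; ring.
  have dW : is_derive (0:R) (1:R) W (a 0 * y - b 0 * x).
    have -> : W = b * cst (a 0) - a * cst (b 0) by [].
    apply: is_derive_eq.
    by rewrite /GRing.scale /=; ring.
  have V0 : V 0 = n ^+ 2 by rewrite nn /V -!expr2.
  have W0 : W 0 = 0 by rewrite /W; ring.
  have V1 : V 0 != 0 by rewrite V0 expf_neq0 // gt_eqF.
  have dVi := is_deriveV V1 dV.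
  have dq : is_derive (0:R) (1:R) (fun t => W t / V t) c.
    have -> : (fun t => W t / V t) = W * (fun t => (V t)^-1) by [].
    apply: is_derive_eq.
    by rewrite /GRing.scale /= W0 mul0r add0r V0 nn /c -/(a 0) -/(b 0) mulrC.
  have da' : is_derive (0:R) (1:R) (fun t => atan (W t / V t))
      ((1 + (W 0 / V 0) ^+ 2)^-1 * c).
    exact: (@is_derive1_comp _ atan (fun t => W t / V t)).
  have -> : (fun t => t0 + atan (W t / V t)) =
     cst t0 + (fun t => atan (W t / V t)) by [].
  apply: is_derive_eq.
  by rewrite W0 mul0r expr0n addr0 invr1 mul1r add0r.
rewrite /darg U.
by case: xgetP => [? ->//|/(_ c)] //=.
Unshelve. all: by end_near.
Qed.

Local Notation plane := (measurableTypeR R * measurableTypeR R)%type.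

(* Lebesgue measure on the space of [k]-tuples of points of the plane. *)
Fixpoint cfg_measure (k : nat) : set (k.-tuple plane) -> \bar R :=
  if k is k'.+1 then
    pushforward ((lebesgue_measure \x lebesgue_measure) \x @cfg_measure k')%E
      (fun p : plane * k'.-tuple plane => [tuple of p.1 :: p.2])
  else \d_[tuple].

Variable k : nat.
Implicit Types (z : k.-tuple plane) (G : graph k) (e : edge k) (w : vertex k).

Definition configurations : set (k.-tuple plane) :=
  [set z | (forall i, 0 < (tnth z i).2) /\ injective (tnth z)].

Definition position z w : R[i] :=
  match w with
  | inl i => ((tnth z i).1 +i* (tnth z i).2)%C
  | inr b => if b then 1 else 0
  end.

(* [phi_e] is the argument of this ratio. *)
Definition angle_ratio G e z : R[i] :=
  (position z (G e) - position z (inl e.1)) /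
  (position z (G e) - (position z (inl e.1))^*).

(* The real coordinates of a configuration are indexed by the same type as the
   edges: [(v, false)] is the abscissa and [(v, true)] the ordinate of [z_v]. *)
Definition shift z (c : 'I_k * bool) (t : R) : k.-tuple plane :=
  [tuple (if i == c.1 then
            if c.2 then ((tnth z i).1, (tnth z i).2 + t)
            else ((tnth z i).1 + t, (tnth z i).2)
          else tnth z i) | i < k].

(* Density of the form [/\_v d phi_(e_v^1) /\ d phi_(e_v^2)] with respect to
   [dx_1 dy_1 ... dx_k dy_k].  As rows and columns are enumerated in the same
   order, the determinant does not depend on this order. *)
Definition weight_density G z : R :=
  \det (\matrix_(i < #|{: edge k}|, j < #|{: 'I_k * bool}|)
          darg (fun t => angle_ratio G (enum_val i) (shift z (enum_val j) t))).

Definition weight G : R :=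
  (2 ^+ k * (2 * pi) ^+ (2 * k))^-1 *
  fine (\int[@cfg_measure k]_(z in configurations) (weight_density G z)%:E).

End Weights.

Section Star.
Variables (R : realType) (N : nat) (pi_ : 'M[{mpoly R[N]}]_N).

Section Graph.
Variables (k : nat) (G : graph k).

(* Exponents of the partial derivatives acting at the vertex [w] when the edges
   carry the labels [I]. *)
Definition diff_at (I : {ffun edge k -> 'I_N}) (w : vertex k) : 'X_{1..N} :=
  (\sum_(e : edge k | G e == w) U_(I e))%MM.

Definition B_graph (f g : {mpoly R[N]}) : {mpoly R[N]} :=
  \sum_(I : {ffun edge k -> 'I_N})
    (\prod_(v < k) (pi_ (I (v, false)) (I (v, true)))^`M[diff_at I (inl v)]) *
    f^`M[diff_at I (inr false)] * g^`M[diff_at I (inr true)].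

End Graph.

Definition B (k : nat) (f g : {mpoly R[N]}) : {mpoly R[N]} :=
  \sum_(G : graph k | admissible G)
    (weight R G / (k`!)%:R) *: B_graph G f g.

(* Power series in [hbar]: [F m] is the coefficient of [hbar^m]. *)
Definition hseries : Type := nat -> {mpoly R[N]}.

Definition hconst (f : {mpoly R[N]}) : hseries :=
  fun m => if m is 0 then f else 0.

Definition star (F G : hseries) : hseries := fun m =>
  \sum_(i < m.+1) \sum_(j < (m - i).+1) B (m - i - j) (F i) (G j).

End Star.

Section MultiSymmetric.
Variables (R : realType) (d n : nat).

(* [mxvec_index i j] is the index of the coordinate [x_ij] of [(R^d)^n]. *)
Definition at_point (i : 'I_n) (f : {mpoly R[d]}) : {mpoly R[n * d]} :=
  f \mPo [tuple 'X_(mxvec_index i j) | j < d].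

Definition coord_pair (c : 'I_(n * d)) : 'I_n * 'I_d :=
  enum_val (cast_ord (esym (mxvec_cast n d)) c).

Lemma mxvec_indexK (i : 'I_n) (j : 'I_d) :
  coord_pair (mxvec_index i j) = (i, j).
Proof. by rewrite /coord_pair cast_ordK enum_rankK. Qed.

Definition product_poisson (pi_ : 'M[{mpoly R[d]}]_d) :
    'M[{mpoly R[n * d]}]_(n * d) :=
  \matrix_(c, c')
    if (coord_pair c).1 == (coord_pair c').1
    then at_point (coord_pair c).1 (pi_ (coord_pair c).2 (coord_pair c').2)
    else 0.

(* [{cmonom S}] is the type of finitely supported functions from [S] to [nat].
   The coefficient of [t^delta] only involves the variables [t_s] with [s] in
   the support of [delta]; the other ones are set to 0, so that the sum over
   [s] is finite.  [mkmalgU (ucm s) c] is the term [c t_s].  The coefficient is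
   0 when the degree of [delta] exceeds [n]. *)
Definition multisym (S : choiceType) (delta : cmonom S)
    (u : S -> {mpoly R[d]}) : {mpoly R[n * d]} :=
  monalg.mcoeff delta
    (\prod_(i < n) (1 + \sum_(s <- finsupp delta)
                          @mkmalgU (cmonom S) _ (ucm s) (at_point i (u s)))).

End MultiSymmetric.
Arguments multisym {R d} n {S} delta u.

Section Indices.
Variables (a b : nat).

(* [lift ord0 l : 'I_a.+1] is the element of {0, ..., a} corresponding to the
   element [l : 'I_a] of {1, ..., a}. *)
Local Notation index := ('I_a.+1 * 'I_b.+1 * nat)%type.

(* A function with finite total sum has finite support, so working in
   [cmonom index] is no restriction. *)
Definition Q (alpha : cmonom 'I_a) (beta : cmonom 'I_b) (n m : nat) :
    set (cmonom index) :=
  [set g : cmonom index |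
    ((forall k, g (ord0, ord0, k) = 0%N) /\
     (forall l r k, l = ord0 \/ r = ord0 -> (1 <= k)%N -> g (l, r, k) = 0%N)) /\
    [/\ (monalg.mdeg g <= n)%N,
        (\sum_(s <- finsupp g) s.2 * g s)%N = m,
        forall l : 'I_a,
          (\sum_(s <- finsupp g | s.1.1 == lift ord0 l) g s)%N = alpha l
      & forall r : 'I_b,
          (\sum_(s <- finsupp g | s.1.2 == lift ord0 r) g s)%N = beta r]].

Variables (R : realType) (d : nat) (pi_ : 'M[{mpoly R[d]}]_d).
Variables (p : 'I_a -> {mpoly R[d]}) (q : 'I_b -> {mpoly R[d]}).

(* The value 0 is used at the indices at which every element of [Q] vanishes. *)
Definition B_family (s : index) : {mpoly R[d]} :=
  match unlift ord0 s.1.1, unlift ord0 s.1.2 with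
  | Some l, Some r => B pi_ s.2 (p l) (q r)
  | Some l, None => if s.2 == 0%N then p l else 0
  | None, Some r => if s.2 == 0%N then q r else 0
  | None, None => 0
  end.

End Indices.

(* Main.v *)
Require Import Defs.
From HB Require Import structures.
From mathcomp Require Import all_boot all_order all_algebra finmap.
From mathcomp Require Import perm.
From mathcomp Require Import -(notations) monalg.
From mathcomp Require Import mpoly.
From mathcomp Require Import all_classical all_reals all_analysis.
From mathcomp Require Import measurable_realfun.
From mathcomp Require Import complex ring lra.

Set Implicit Arguments.
Unset Strict Implicit.
Unset Printing Implicit Defensive.

Import Order.TTheory GRing.Theory Num.Theory.
Import numFieldNormedType.Exports.
Local Open Scope ring_scope.

(* Up to a null set, the configurations of a disjoint union of two
   graphs are pairs of configurations, and on them the angle form factorises;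
   by Fubini the weight is multiplicative.  The (deep) convergence of the
   integrals is not needed: [fine] maps infinite integrals to 0, also those of
   the form oo - oo, so the product formula survives divergence.  If no edge
   ends at [L], or none at [R], all angles are invariant under the dilations
   centred at the other point, so the form vanishes; hence
   [B_k(1, g) = B_k(f, 1) = 0] for [k > 0].

   As the product Poisson structure does not mix the [n] points, a graph that
   contributes to [B_k] on [prod_i f_i(i)] and [prod_i g_i(i)] is a disjoint
   union of graphs attached to the points, and the number of ways to distribute
   the labels of the vertices absorbs the factorials: the result is
   [sum_(k_1 + ... + k_n = k) prod_i B_(k_i)(f_i, g_i)(i)].
   Finally [e_alpha(p)] is the sum of [prod_i p_(phi i)(i)] over the maps [phi]
   from the points to [{0, ..., a}] with fibres of size [alpha] (and [p_0 = 1]),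
   and the triples [(phi i, psi i, k_i)] are counted by the indices in [Q]. *)

(** * Integrals on configuration spaces *)

Section FineProduct.
Local Open Scope ereal_scope.
Context d1 d2 (T1 : measurableType d1) (T2 : measurableType d2) (R : realType).
Variable m1 : {sigma_finite_measure set T1 -> \bar R}.
Variable m2 : {sigma_finite_measure set T2 -> \bar R}.

(** Tonelli evaluates the integral of the absolute value as [a * b]. If this is 0, or if it is
    infinite and [fine] yields 0 on both sides, the formula is immediate; otherwise everything is
    integrable and Fubini applies. *)
Lemma fine_integral_prod (f1 : T1 -> R) (f2 : T2 -> R) :
  measurable_fun [set: T1] f1 -> measurable_fun [set: T2] f2 ->
  fine (\int[m1 \x m2]_z (f1 z.1 * f2 z.2)%:E) =
  (fine (\int[m1]_x (f1 x)%:E) * fine (\int[m2]_x (f2 x)%:E))%R.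
Proof.
move=> mf1 mf2.
pose f (z : T1 * T2) := (f1 z.1 * f2 z.2)%R.
have mf : measurable_fun [set: T1 * T2] f.
  by apply: measurable_funM; exact: measurableT_comp.
have ma1 : measurable_fun [set: T1] (fun x => `|(f1 x)%:E|).
  by apply: measurableT_comp => //; exact/measurable_EFinP.
have ma2 : measurable_fun [set: T2] (fun x => `|(f2 x)%:E|).
  by apply: measurableT_comp => //; exact/measurable_EFinP.
have mfE : measurable_fun [set: T1 * T2] (fun z => `|(f z)%:E|).
  by apply: measurableT_comp => //; exact/measurable_EFinP.
set a := \int[m1]_x `|(f1 x)%:E|; set b := \int[m2]_x `|(f2 x)%:E|.
have a0 : 0 <= a by exact: integral_ge0.
have b0 : 0 <= b by exact: integral_ge0.
have abE : \int[m1 \x m2]_z `|(f z)%:E| = a * b.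
  rewrite fubini_tonelli1 // /fubini_F.
  rewrite -ge0_integralZr //; apply: eq_integral => x _.
  rewrite -ge0_integralZl //; apply: eq_integral => y _.
  by rewrite /f EFinM abseM.
have zero0 d (T : measurableType d) (m : {measure set T -> \bar R}) (g : T -> R) :
    measurable_fun [set: T] g -> \int[m]_x `|(g x)%:E| = 0 ->
    \int[m]_x (g x)%:E = 0.
  move=> mg g0.
  have mgE : measurable_fun [set: T] (fun x => (g x)%:E) by exact/measurable_EFinP.
  rewrite -[RHS](integral0 m setT); apply: ae_eq_integral => //.
  exact/ae_eq_integral_abs.
have fin0 d (T : measurableType d) (m : {measure set T -> \bar R}) (g : T -> R) :
    measurable_fun [set: T] g -> \int[m]_x `|(g x)%:E| = +oo ->
    fine (\int[m]_x (g x)%:E) = 0%R.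
  move=> mg goo.
  (* An integral is finite exactly when that of the absolute value is, and [fine] sends both
     infinities to 0. *)
  have := @integral_fin_num_abs _ _ _ m setT g measurableT mg.
  by rewrite goo ltxx => /esym; case: (\int[m]_x _).
(* The zero cases come first, so that an infinite factor below always meets a positive one and
   [a * b] is infinite. *)
have [a00|an0] := eqVneq a 0.
  by rewrite (zero0 _ _ _ f) ?abE ?a00 ?mul0e // (zero0 _ _ _ f1) //= mul0r.
have [b00|bn0] := eqVneq b 0.
  by rewrite (zero0 _ _ _ f) ?abE ?b00 ?mule0 // (zero0 _ _ _ f2) //= mulr0.
have ap : 0 < a by rewrite lt0e an0.
have bp : 0 < b by rewrite lt0e bn0.
have [aoo|afin] := eqVneq a +oo.
  by rewrite (fin0 _ _ _ f) ?abE ?aoo ?gt0_mulye // (fin0 _ _ _ f1) ?mul0r.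
have [boo|bfin] := eqVneq b +oo.
  by rewrite (fin0 _ _ _ f) ?abE ?boo ?gt0_muley // (fin0 _ _ _ f2) ?mulr0.
have {}afin : a < +oo by rewrite ltey.
have {}bfin : b < +oo by rewrite ltey.
have i1 : m1.-integrable setT (EFin \o f1).
  by apply/integrableP; split => //; exact/measurable_EFinP.
have i2 : m2.-integrable setT (EFin \o f2).
  by apply/integrableP; split => //; exact/measurable_EFinP.
have i12 : (m1 \x m2).-integrable setT (EFin \o f).
  apply/integrableP; split; first exact/measurable_EFinP.
  by rewrite abE lte_mul_pinfty // ge0_fin_numE.
have finb := integrable_fin_num measurableT i2.
rewrite -fineM ?(integrable_fin_num measurableT i1) //; congr fine.
rewrite -(integral12_prod_meas1 i12) /fubini_F.
rewrite -[X in _ = _ * X](fineK finb) -integralZr //.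
apply: eq_integral => x _; rewrite fineK // -integralZl //.
Qed.

End FineProduct.

(** * Measures on tuples are determined by their values on boxes *)

Section TupleMeasure.
Context d (T : measurableType d) (R : realType) (k : nat).
Local Open Scope classical_set_scope.
Local Open Scope ereal_scope.

Definition box (A : 'I_k -> set T) : set (k.-tuple T) :=
  [set z | forall i, A i (tnth z i)].

Lemma measurable_box (A : 'I_k -> set T) :
  (forall i, measurable (A i)) -> measurable (box A).
Proof.
move=> mA.
rewrite (_ : box A = \big[setI/setT]_(i < k) ((@tnth _ T ^~ i) @^-1` A i)).
  apply: bigsetI_measurable => i _; rewrite -[X in measurable X]setTI.
  exact: measurable_tnth.
apply/seteqP; split => [z Az|z]; rewrite -bigcap_seq; first by move=> i _; exact: Az.
by move=> h i; apply: (h i); rewrite /= mem_index_enum.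
Qed.

(** Boxes, unlike the preimages under a single coordinate, are stable under intersection, as the
    uniqueness theorem for measures requires. *)
Lemma measurable_tupleE :
  (measurable : set (set (k.-tuple T))) =
  <<s [set box A | A in [set A | forall i, measurable (A i)]] >>.
Proof.
apply/seteqP; split.
  apply: smallest_sub; first exact: smallest_sigma_algebra.
  move=> X; rewrite -bigcup_seq => -[i _ [A mA <-]].
  apply: sub_sigma_algebra; exists (fun j => if j == i then A else setT).
    by move=> j; case: ifP.
  rewrite setTI; apply/seteqP; split => [z /= /(_ i)|z /= Az j].
    by rewrite eqxx.
  by case: eqP => [->|].
apply: smallest_sub; first exact: sigma_algebra_measurable.
by move=> _ [A mA <-]; exact: measurable_box.
Qed.

Lemma box_exhaustion (m : {sigma_finite_measure set T -> \bar R}) :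
  exists F : (set T)^nat, [/\ forall n, measurable (F n),
    \bigcup_n box (fun=> F n) = setT & forall n, \prod_(i < k) m (F n) < +oo].
Proof.
have /sigma_finiteP[F [TF ndF Foo]] := sigma_finiteT m.
exists F; split => [n||n]; first by case: (Foo n).
  apply/seteqP; split => // z _.
  have /choice[N hN] : forall i, exists n, F n (tnth z i).
    move=> i; have : [set: T] (tnth z i) by [].
    by rewrite TF => -[n _ Fn]; exists n.
  (* The sequence [F] is nondecreasing, so the largest of the finitely many levels serves all
     coordinates. *)
  exists (\max_i N i)%N => // i.
  have /subsetPset := ndF _ _ (leq_bigmax i : (N i <= \max_i N i)%N).
  by apply; exact: hN.
suff : 0 <= \prod_(i < k) m (F n) < +oo by case/andP.
elim/big_ind: _ => [|x y /andP[x0 xoo] /andP[y0 yoo]|i _].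
+ by rewrite lee01 ltry.
+ by rewrite mule_ge0 //= lte_mul_pinfty // ge0_fin_numE.
+ by rewrite measure_ge0; case: (Foo n).
Qed.

(** Boxes form a generating pi-system, and the cubes of [box_exhaustion] cover the space by sets of
    finite measure. *)
Lemma tuple_measure_unique (m : {sigma_finite_measure set T -> \bar R})
    (m1 m2 : {measure set (k.-tuple T) -> \bar R}) :
  (forall A, (forall i, measurable (A i)) -> m1 (box A) = \prod_(i < k) m (A i)) ->
  (forall A, (forall i, measurable (A i)) -> m2 (box A) = \prod_(i < k) m (A i)) ->
  forall X, measurable X -> m1 X = m2 X.
Proof.
move=> h1 h2.
have [F [mF FT Foo]] := box_exhaustion m.
apply: (measure_unique [set box A | A in [set A | forall i, measurable (A i)]]
         (fun n => box (fun=> F n))) => //.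
- exact: measurable_tupleE.
- move=> _ _ [A mA <-] [B mB <-]; exists (fun i => A i `&` B i).
    by move=> i; exact: measurableI.
  by apply/seteqP; split => [z h|z [hA hB] i]; [split => i; case: (h i)|split].
- by move=> n; exists (fun=> F n).
- by move=> _ [A mA <-]; rewrite h1 // h2.
- by move=> n; rewrite h1.
Qed.

End TupleMeasure.

(** * Change of variables for pushforward measures *)

Section Pushforward.
Local Open Scope classical_set_scope.
Local Open Scope ereal_scope.
Context d1 d2 (T1 : measurableType d1) (T2 : measurableType d2) (R : realType).

Definition pushforward_measure (m : {measure set T1 -> \bar R}) (f : T1 -> T2)
    (mf : measurable_fun [set: T1] f) : {measure set T2 -> \bar R} :=
  measure_function_pushforward__canonical__measure_function_Measure m mf.

(** The formula for nonnegative functions is applied to the positive and negative parts, so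
    divergent integrals are covered too. *)
Lemma integral_pushforward_measurable (m : {measure set T1 -> \bar R})
    (f : T1 -> T2) (g : T2 -> \bar R) :
  measurable_fun [set: T1] f -> measurable_fun [set: T2] g ->
  \int[pushforward m f]_y g y = \int[m]_x g (f x).
Proof.
move=> mf mg; rewrite [RHS]integralE.
rewrite (integralE (pushforward_measure m mf)).
have P := @ge0_integral_pushforward _ _ _ _ _ f mf m setT.
rewrite !preimage_setT in P.
congr (_ - _); rewrite P //.
- by apply: eq_integral => x _; rewrite /= !funeposE.
- exact: measurable_funepos.
- by apply: eq_integral => x _; rewrite /= !funenegE.
- exact: measurable_funeneg.
Qed.

End Pushforward.

Notation plane R := (measurableTypeR R * measurableTypeR R)%type.

(** * The measure on configurations as a sigma-finite product measure *)

Section CfgMeasure.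
Local Open Scope classical_set_scope.
Local Open Scope ereal_scope.
Context (R : realType).

Let leb : {sigma_finite_measure set (measurableTypeR R) -> \bar R} :=
  @lebesgue_measure R.

Let plane_measure_sigma_finite := Measure_isSigmaFinite.Build _ _ _
  (leb \x leb) (isSigmaFinite.sigma_finiteT
    (lebesgue_integral_fubini.measure_function_Measure_isSigmaFinite__to__measure_function_isSigmaFinite
      leb leb)).

Definition plane_measure : {sigma_finite_measure set (plane R) -> \bar R} :=
  HB.pack (leb \x leb) plane_measure_sigma_finite.

Lemma sigma_finite_boxes k (mu : set (k.-tuple (plane R)) -> \bar R) :
  (forall A, (forall i, measurable (A i)) ->
    mu (box A) = \prod_(i < k) plane_measure (A i)) ->
  sigma_finite [set: k.-tuple (plane R)] mu.
Proof.
move=> h.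
have [F [mF FT Foo]] := @box_exhaustion _ (plane R) R k plane_measure.
exists (fun n => box (fun=> F n)) => // n.
by split; [exact: measurable_box|rewrite h].
Qed.

(** [cfg_measure] is a bare set function defined by recursion; its structure of sigma-finite measure
    is built by induction along with its values on boxes, which in turn give the
    sigma-finiteness. *)
Lemma cfg_measureP k :
  exists mu : {sigma_finite_measure set (k.-tuple (plane R)) -> \bar R},
  @cfg_measure R k = mu /\
  forall A, (forall i, measurable (A i)) ->
    mu (box A) = \prod_(i < k) plane_measure (A i).
Proof.
elim: k => [|k [mu [muE muB]]].
  exists \d_[tuple]; split => // A mA.
  rewrite big_ord0 /= diracE mem_set //=.
  by case.
pose f (p : plane R * k.-tuple (plane R)) := [tuple of p.1 :: p.2].
have mf : measurable_fun setT f by apply: measurable_cons.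
pose m := pushforward_measure (plane_measure \x mu) mf.
have mB A : (forall i, measurable (A i)) ->
    m (box A) = \prod_(i < k.+1) plane_measure (A i).
  move=> mA; rewrite /m /= /pushforward.
  (* The preimage of a box under cons is its first side times the box of the other sides. *)
  rewrite (_ : _ @^-1` _ = A ord0 `*` box (fun i => A (lift ord0 i))).
    rewrite product_measure1E //; last exact: measurable_box.
    by rewrite big_ord_recl muB.
  apply/seteqP; split => [[x z] h|[x z] [h1 h2] i] /=.
    split; first exact: (h ord0).
    by move=> i; have := h (lift ord0 i); rewrite tnthS.
  by case: (unliftP ord0 i) => [j|] ->; rewrite ?tnthS //; exact: h2.
pose mm := Measure_isSigmaFinite.Build _ _ _ m (sigma_finite_boxes mB).
pose M : {sigma_finite_measure set (k.+1.-tuple (plane R)) -> \bar R} :=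
  HB.pack (Measure.sort m) mm.
exists M; split => //.
by rewrite /= muE.
Qed.

Definition cfg_sigma_measure k := projT1 (cid (cfg_measureP k)).

Lemma cfg_measureE k : @cfg_measure R k = cfg_sigma_measure k.
Proof. by rewrite /cfg_sigma_measure; case: cid => mu []. Qed.

Lemma cfg_sigma_measure_box k (A : 'I_k -> set (plane R)) : (forall i, measurable (A i)) ->
  cfg_sigma_measure k (box A) = \prod_(i < k) plane_measure (A i).
Proof. by rewrite /cfg_sigma_measure; case: cid => mu [_] /= /(_ A). Qed.

End CfgMeasure.

(** * Configurations of a disjoint union of vertex sets *)

Section Split.
Local Open Scope classical_set_scope.
Local Open Scope ereal_scope.
Context (R : realType) (k1 k2 k : nat).
Variables (h : 'I_k1 + 'I_k2 -> 'I_k) (hinv : 'I_k -> 'I_k1 + 'I_k2).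
Hypotheses (hK : cancel h hinv) (hinvK : cancel hinv h).
Local Notation conf m := (m.-tuple (plane R)).

Definition merge (z1 : conf k1) (z2 : conf k2) : conf k :=
  [tuple match hinv i with inl a => tnth z1 a | inr b => tnth z2 b end | i < k].

Lemma measurable_merge :
  measurable_fun [set: conf k1 * conf k2] (fun z => merge z.1 z.2).
Proof.
apply/measurable_fun_tnthP => i.
rewrite (_ : _ \o _ = fun z : conf k1 * conf k2 =>
    match hinv i with inl a => tnth z.1 a | inr b => tnth z.2 b end).
  by case: (hinv i) => j;
    apply: (measurableT_comp (measurable_tnth _)).
by apply/funext => z /=; rewrite tnth_mktuple.
Qed.

Local Notation mu1 := (cfg_sigma_measure R k1).
Local Notation mu2 := (cfg_sigma_measure R k2).

(** Both measures give a box the product of the measures of its sides, which [h] splits into two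
    groups. *)
Lemma cfg_measure_merge X : measurable X ->
  cfg_sigma_measure R k X = pushforward (mu1 \x mu2) (fun z => merge z.1 z.2) X.
Proof.
move=> mX.
apply: (@tuple_measure_unique _ _ _ _ (plane_measure R) (cfg_sigma_measure R k)
  (pushforward_measure (mu1 \x mu2) measurable_merge)) => // A mA.
  exact: (cfg_sigma_measure_box mA).
rewrite [LHS](_ : _ = (mu1 \x mu2)
    (box (fun a => A (h (inl a))) `*` box (fun b => A (h (inr b))))).
  rewrite product_measure1E; [|exact: measurable_box..].
  rewrite (reindex h); last by exists hinv => ? _.
  by rewrite big_sumType; congr (_ * _); exact: cfg_sigma_measure_box.
rewrite /= /pushforward; congr ((mu1 \x mu2) _).
apply/seteqP; split => [[z1 z2] /= H|[z1 z2] /= [H1 H2] i].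
  by split => j; [have := H (h (inl j))|have := H (h (inr j))];
    rewrite tnth_mktuple hK.
by rewrite tnth_mktuple -{1}(hinvK i); case: (hinv i).
Qed.

Lemma plane_measure_vertical (c : R) :
  plane_measure R ([set c] `*` setT) = 0.
Proof. by rewrite [LHS]product_measure1E //= lebesgue_measure_set1 mul0e. Qed.

(** Serves to discard the pairs of configurations that collide when merged. For fixed [z1],
    prescribing one abscissa in [z2] gives a box with a vertical line as a side, hence a null set,
    and there are finitely many pairs [i], [j]. *)
Lemma ae_abscissa_neq :
  \forall z \ae mu1 \x mu2, forall i j, (tnth z.1 i).1 != (tnth z.2 j).1 :> R.
Proof.
apply: filter_forall => i; apply: filter_forall => j.
have mE : measurable [set z : conf k1 * conf k2 |
    (tnth z.1 i).1 == (tnth z.2 j).1 :> R].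
  have m1 : measurable_fun setT (fun z : conf k1 * conf k2 => (tnth z.1 i).1 : R).
    by apply: measurableT_comp => //; apply: (measurableT_comp (measurable_tnth _)).
  have m2 : measurable_fun setT (fun z : conf k1 * conf k2 => (tnth z.2 j).1 : R).
    by apply: measurableT_comp => //; apply: (measurableT_comp (measurable_tnth _)).
  by have := measurable_fun_eqr m1 m2 measurableT (Y := [set true]) I; rewrite setTI.
exists [set z : conf k1 * conf k2 | (tnth z.1 i).1 == (tnth z.2 j).1 :> R]; split => //.
  rewrite /= /product_measure1 integral0_eq // => z1 _.
  rewrite /= (_ : xsection _ _ = box (fun b => if b == j then
      [set (tnth z1 i).1] `*` setT else setT)).
    rewrite cfg_sigma_measure_box; last by move=> b; case: ifP => // _; exact: measurableX.
    by rewrite (bigD1 j) //= eqxx plane_measure_vertical mul0e.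
  apply/seteqP; split => z2.
    by rewrite /xsection /= inE /= => /eqP E b; case: eqP => [->|].
  by move/(_ j); rewrite eqxx /xsection /= inE /= => -[/= -> _].
by move=> z /= /negP; rewrite negbK.
Qed.

(** Change of variables along [merge]; the factorisation of [g] holds off a null set, and
    [fine_integral_prod] concludes. *)
Lemma fine_integral_merge (g : conf k -> R) (f1 : conf k1 -> R) (f2 : conf k2 -> R) :
  measurable_fun setT g -> measurable_fun setT f1 -> measurable_fun setT f2 ->
  (forall z1 z2, (forall i j, (tnth z1 i).1 != (tnth z2 j).1 :> R) ->
    g (merge z1 z2) = (f1 z1 * f2 z2)%R) ->
  fine (\int[@cfg_measure R k]_z (g z)%:E) =
  (fine (\int[@cfg_measure R k1]_z (f1 z)%:E) *
   fine (\int[@cfg_measure R k2]_z (f2 z)%:E))%R.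
Proof.
move=> mg mf1 mf2 gE.
rewrite !cfg_measureE -fine_integral_prod //; congr fine.
rewrite (eq_measure_integral (pushforward_measure (mu1 \x mu2) measurable_merge)).
  rewrite [LHS]integral_pushforward_measurable; last exact/measurable_EFinP;
    last exact: measurable_merge.
  apply: ae_eq_integral => //.
  - apply/measurable_EFinP; apply: measurableT_comp => //; exact: measurable_merge.
  - apply/measurable_EFinP.
    by apply: measurable_funM; exact: measurableT_comp.
  - have [N [mN N0 sN]] := ae_abscissa_neq.
    exists N; split => // z hz; apply: sN => /= hn; apply: hz => _.
    by rewrite gE.
by move=> A mA _; exact: cfg_measure_merge.
Qed.

End Split.

(** * Angles and weights *)

Section Angle.
Context (R : realType) (k : nat).
Local Notation conf := (k.-tuple (plane R)).
Implicit Types (z : conf) (G : graph k) (e : edge k) (w : vertex k).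
Implicit Types (a b x y : R).

(* [Im ((a + i b) / (x + i y))] *)
Definition im_quot a b x y : R := (b * x - a * y) / (x ^+ 2 + y ^+ 2).

Definition point z w : R * R :=
  match w with inl i => tnth z i | inr s => (s%:R, 0) end.

(** Velocity of a vertex under the motion [u]; [L] and [R] stay fixed. *)
Definition displacement (u : 'I_k -> R * R) w : R * R :=
  match w with inl i => u i | inr _ => (0, 0) end.

(** Closed form of the differential of the angle along [u]: the variation of [arg (w - v)] minus
    that of [arg (w - conj v)]. The sign in [dw.2 + dv.2] and [w.2 + v.2] comes from the
    conjugate. *)
Definition dangle G e z (u : 'I_k -> R * R) : R :=
  let v := point z (inl e.1) in let w := point z (G e) in
  let dv := displacement u (inl e.1) in let dw := displacement u (G e) in
  im_quot (dw.1 - dv.1) (dw.2 - dv.2) (w.1 - v.1) (w.2 - v.2) -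
  im_quot (dw.1 - dv.1) (dw.2 + dv.2) (w.1 - v.1) (w.2 + v.2).

Definition unit_displacement (c : 'I_k * bool) (i : 'I_k) : R * R :=
  if i == c.1 then (if c.2 then (0, 1) else (1, 0)) else (0, 0).

Lemma is_derive_affine (x a : R) : is_derive (0 : R) (1 : R) (fun t => x + t * a) a.
Proof.
have -> : (fun t : R => x + t * a) = cst x + id * cst a by [].
by apply: is_derive_eq; rewrite /GRing.scale /=; ring.
Qed.

(** The argument of a quotient is a difference of arguments. Numerator and denominator share their
    real part because [w - v] and [w - conj v] do. *)
Lemma darg_quot (x y y' a b b' : R) :
  x ^+ 2 + y ^+ 2 != 0 -> x ^+ 2 + y' ^+ 2 != 0 ->
  darg (fun t => ((x + t * a) +i* (y + t * b))%C / ((x + t * a) +i* (y' + t * b'))%C) =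
  im_quot a b x y - im_quot a b' x y'.
Proof.
move=> n1 n2.
pose X t := x + t * a; pose Y t := y + t * b; pose Y' t := y' + t * b'.
pose D t := X t ^+ 2 + Y' t ^+ 2.
pose u t := ((X t +i* Y t) / (X t +i* Y' t))%C.
have dX : is_derive (0 : R) (1 : R) X a := is_derive_affine x a.
have dY : is_derive (0 : R) (1 : R) Y b := is_derive_affine y b.
have dY' : is_derive (0 : R) (1 : R) Y' b' := is_derive_affine y' b'.
have X0 : X 0 = x by rewrite /X mul0r addr0.
have Y0 : Y 0 = y by rewrite /Y mul0r addr0.
have Y'0 : Y' 0 = y' by rewrite /Y' mul0r addr0.
have D0 : D 0 != 0 by rewrite /D X0 Y'0.
have dD : is_derive (0 : R) (1 : R) D (2 * x * a + 2 * y' * b').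
  have -> : D = X * X + Y' * Y' by apply/funext => t; rewrite /D !expr2.
  by apply: is_derive_eq; rewrite /GRing.scale /= X0 Y'0; ring.
have dDi := is_deriveV D0 dD.
have reE t : complex.Re (u t) = (X t * X t + Y t * Y' t) * (D t)^-1.
  by rewrite /u /= /D; ring.
have imE t : complex.Im (u t) = (Y t * X t - X t * Y' t) * (D t)^-1.
  by rewrite /u /= /D; ring.
have dre : is_derive (0 : R) (1 : R) (fun t => complex.Re (u t))
    ((2 * x * a + y * b' + y' * b) * (D 0)^-1 -
     (x * x + y * y') * (D 0)^-1 ^+ 2 * (2 * x * a + 2 * y' * b')).
  have -> : (fun t => complex.Re (u t)) = (X * X + Y * Y') * (fun t => (D t)^-1).
    by apply/funext => t; rewrite reE.
  apply: is_derive_eq; rewrite /GRing.scale /= -exprVn.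
  change ((X * X + Y * Y') 0) with (X 0 * X 0 + Y 0 * Y' 0).
  by rewrite X0 Y0 Y'0; ring.
have dim : is_derive (0 : R) (1 : R) (fun t => complex.Im (u t))
    ((y * a + b * x - x * b' - a * y') * (D 0)^-1 -
     (y * x - x * y') * (D 0)^-1 ^+ 2 * (2 * x * a + 2 * y' * b')).
  have -> : (fun t => complex.Im (u t)) = (Y * X - X * Y') * (fun t => (D t)^-1).
    by apply/funext => t; rewrite imE.
  apply: is_derive_eq; rewrite /GRing.scale /= -exprVn.
  change ((Y * X - X * Y') 0) with (Y 0 * X 0 - X 0 * Y' 0).
  by rewrite X0 Y0 Y'0; ring.
(* The squared modulus of the numerator times the conjugate denominator; it also shows that the
   curve does not start at 0. *)
have n3 : (x * x + y * y') ^+ 2 + (y * x - x * y') ^+ 2 != 0.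
  have -> : (x * x + y * y') ^+ 2 + (y * x - x * y') ^+ 2 =
    (x ^+ 2 + y ^+ 2) * (x ^+ 2 + y' ^+ 2) by ring.
  by rewrite mulf_neq0.
rewrite (dargE _ dre dim).
  rewrite reE imE /D X0 Y0 Y'0 /im_quot; field.
  by rewrite n1 n2 n3.
apply/negP => /eqP u0.
move/negP: n3; apply; apply/eqP.
have := reE 0; have := imE 0; rewrite u0 /= X0 Y0 Y'0 => /esym/eqP + /esym/eqP.
rewrite !mulf_eq0 invr_eq0 (negPf D0) !orbF => /eqP -> /eqP ->.
by rewrite expr0n addr0.
Qed.

Lemma darg_angle_ratio G e z c : configurations z -> G e != inl e.1 ->
  darg (fun t => angle_ratio G e (Defs.shift z c t)) = dangle G e z (unit_displacement c).
Proof.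
move=> [zpos zinj] nloop.
have posE t w : position (Defs.shift z c t) w =
    (((point z w).1 + t * (displacement (unit_displacement c) w).1) +i*
     ((point z w).2 + t * (displacement (unit_displacement c) w).2))%C.
  case: w => [i|s] /=; last by rewrite !mulr0 !addr0; case: s.
  rewrite /Defs.shift tnth_mktuple /unit_displacement.
  by case: eqP => _; [case: c.2|]; rewrite /= ?mulr0 ?mulr1 ?addr0.
rewrite /dangle -darg_quot.
- congr darg; apply/funext => t; rewrite /angle_ratio !posE.
  by congr (_ / _); apply/eqP; rewrite eq_complex /=; apply/andP; split;
    apply/eqP; ring.
(* [w - v] is not 0: [L] and [R] lie on the real line, below all inner vertices, and distinct inner
   vertices are distinct points. *)
- case: (G e) nloop => [j|s] /= nloop; last first.
    by rewrite sub0r sqrrN gt_eqF // ltr_wpDl ?sqr_ge0 // exprn_gt0 ?zpos.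
  rewrite paddr_eq0 ?sqr_ge0 // !sqrf_eq0 !subr_eq0 -xpair_eqE -!surjective_pairing.
  by apply: contraNneq nloop => /zinj ->.
(* [w - conj v] has positive imaginary part. *)
- rewrite gt_eqF // ltr_wpDl ?sqr_ge0 // exprn_gt0 // ltr_wpDl ?zpos //.
  by case: (G e) => [j|s] //=; rewrite ltW ?zpos.
Qed.

End Angle.

(** * Determinants of matrices indexed by finite types *)

Section Determinants.

(** Rows and columns undergo the same permutation, so its sign appears twice. *)
Lemma det_reindex (R : comRingType) (T : finType) (f : T -> T -> R) m (phi : 'I_m -> T) :
  bijective phi ->
  \det (\matrix_(i < #|T|, j < #|T|) f (enum_val i) (enum_val j)) =
  \det (\matrix_(i < m, j < m) f (phi i) (phi j)).
Proof.
move=> bphi.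
have mE : m = #|T| by rewrite -(bij_eq_card bphi) card_ord.
subst m.
have inj_s : injective (fun i => enum_rank (phi i)).
  by move=> i j /enum_rank_inj /(bij_inj bphi).
pose s := perm inj_s.
have -> : (\matrix_(i, j) f (phi i) (phi j)) =
    row_perm s (col_perm s (\matrix_(i < #|T|, j < #|T|) f (enum_val i) (enum_val j))).
  by apply/matrixP => i j; rewrite !mxE !permE !enum_rankK.
rewrite row_permE col_permE !det_mulmx !det_perm odd_permV.
by rewrite mulrC -mulrA -expr2 sqrr_sign mulr1.
Qed.

(** In an enumeration listing [T1] before [T2] the matrix is block upper triangular. *)
Lemma det_block_diag (R : comRingType) (T T1 T2 : finType) (f : T -> T -> R)
    (h1 : T1 -> T) (h2 : T2 -> T) (hinv : T -> T1 + T2) :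
  let h s := match s with inl x => h1 x | inr y => h2 y end in
  cancel h hinv -> cancel hinv h ->
  (forall x y, f (h2 y) (h1 x) = 0) ->
  \det (\matrix_(i < #|T|, j < #|T|) f (enum_val i) (enum_val j)) =
  \det (\matrix_(i < #|T1|, j < #|T1|) f (h1 (enum_val i)) (h1 (enum_val j))) *
  \det (\matrix_(i < #|T2|, j < #|T2|) f (h2 (enum_val i)) (h2 (enum_val j))).
Proof.
move=> h hK hinvK f21.
pose phi (i : 'I_(#|T1| + #|T2|)) :=
  match fintype.split i with inl x => h1 (enum_val x) | inr y => h2 (enum_val y) end.
pose psi t := unsplit match hinv t with
  | inl x => inl (enum_rank x) | inr y => inr (enum_rank y) end.
have phiE s : phi (unsplit s) =
    h match s with inl x => inl (enum_val x) | inr y => inr (enum_val y) end.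
  by rewrite /phi unsplitK; case: s.
have bphi : bijective phi.
  exists psi => [a|t].
    rewrite -{1}(fintype.splitK a) phiE /psi hK -[RHS]fintype.splitK.
    by case: (fintype.split a) => x; rewrite enum_valK.
  rewrite /psi phiE -[RHS]hinvK; case: (hinv t) => x; by rewrite enum_rankK.
have phi1 x : phi (lshift _ x) = h1 (enum_val x) := phiE (inl x).
have phi2 x : phi (rshift _ x) = h2 (enum_val x) := phiE (inr x).
rewrite (det_reindex _ bphi) -[\matrix_(i, j) _]submxK.
rewrite (_ : dlsubmx _ = 0) ?det_ublock.
  by congr (_ * _); congr (\det _); apply/matrixP => i j; rewrite !mxE ?phi1 ?phi2.
by apply/matrixP => i j; rewrite !mxE phi1 phi2 f21.
Qed.

Lemma det_eq0_ker (R : fieldType) (T : finType) (f : T -> T -> R) (xi : T -> R) t0 :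
  xi t0 != 0 -> (forall s, \sum_t f s t * xi t = 0) ->
  \det (\matrix_(i < #|T|, j < #|T|) f (enum_val i) (enum_val j)) = 0.
Proof.
move=> xi0 fxi.
set M := \matrix_(_, _) _.
pose v := \col_(i < #|T|) xi (enum_val i).
have Mv : M *m v = 0.
  apply/matrixP => i j; rewrite !mxE -[RHS](fxi (enum_val i)).
  rewrite (reindex (@enum_val T T)) /=; last first.
    by exists enum_rank => x _; rewrite ?enum_valK ?enum_rankK.
  by apply: eq_bigr => l _; rewrite !mxE.
apply/eqP; apply: contraNT xi0 => dM.
have uM : M \in unitmx by rewrite unitmxE unitfE.
have := mulKmx uM v; rewrite Mv mulmx0 => /matrixP/(_ (enum_rank t0) 0).
by rewrite !mxE enum_rankK => <-.
Qed.

End Determinants.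

(** * The density of the angle form in closed form *)

Section Density.
Context (R : realType).
Local Notation conf k := (k.-tuple (plane R)).

(** Replaces [darg] by its closed form in [weight_density], which yields a function that is visibly
    measurable on the whole space; [weight_densityE] compares the two. *)
Definition ddensity k (G : graph k) (z : conf k) : R :=
  \det (\matrix_(i < #|{: edge k}|, j < #|{: 'I_k * bool}|)
     dangle G (enum_val i) z (unit_displacement R (enum_val j))).

Lemma admissibleP k (G : graph k) : admissible G -> forall e, G e != inl e.1.
Proof. by move=> /forallP aG [v []]; case/and3P: (aG v). Qed.

Lemma weight_densityE k (G : graph k) (z : conf k) :
  configurations z -> admissible G -> weight_density G z = ddensity G z.
Proof.
move=> cz aG; congr (\det _); apply/matrixP => i j; rewrite !mxE.
by rewrite darg_angle_ratio //; exact: admissibleP.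
Qed.

(** [dangle] is linear in the displacement, so a combination of the columns of the matrix is the
    variation of the angle along a vector field. *)
Lemma dangle_sum k (G : graph k) e (z : conf k) (xi : 'I_k * bool -> R) :
  \sum_c dangle G e z (unit_displacement R c) * xi c =
  dangle G e z (fun i => (xi (i, false), xi (i, true))).
Proof.
have dispE w (b : bool) : \sum_(c : 'I_k * bool)
    (if b then (displacement (unit_displacement R c) w).2
     else (displacement (unit_displacement R c) w).1) * xi c =
    if b then (displacement (fun i => (xi (i, false), xi (i, true))) w).2
    else (displacement (fun i => (xi (i, false), xi (i, true))) w).1.
  case: w => [i|s] /=; last first.
    by rewrite big1 => [|c _]; case: b; rewrite ?mul0r.
  rewrite (bigD1 (i, b)) //= big1 => [|[j c]].
    by rewrite /unit_displacement /= eqxx; case: b; rewrite /= mul1r addr0.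
  rewrite xpair_eqE negb_and /unit_displacement /= [i == j]eq_sym.
  by case: eqP => _; case: b; case: c => //= _; rewrite ?mul0r.
have {}dispE w := (dispE w false, dispE w true).
rewrite /dangle; set v := e.1; set p := point z (inl v); set q := point z (G e).
rewrite /im_quot; cbv zeta.
set x := q.1 - p.1; set y := q.2 - p.2; set y' := q.2 + p.2.
set D := (_ + _)^-1; set D' := (_ + _)^-1.
pose al := y' * D' - y * D.
pose F c (b : bool) w := (if b then (displacement (unit_displacement R c) w).2
     else (displacement (unit_displacement R c) w).1) * xi c.
(* The terms are grouped by the four components of the displacements of target and source. *)
transitivity (al * \sum_c F c false (G e) - al * \sum_c F c false (inl v)
   + (x * D - x * D') * \sum_c F c true (G e)
   - (x * D + x * D') * \sum_c F c true (inl v)).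
  rewrite !mulr_sumr -!sumrB -big_split /= -sumrB; apply: eq_bigr => c _.
  by rewrite /F /al /=; ring.
by rewrite !dispE /al /=; ring.
Qed.

(* The angles of edges that only end at [r] or at inner vertices are invariant
   under the dilations of centre [r], so the forms are linearly dependent. *)
Lemma ddensity_eq0 k (G : graph k) (z : conf k) (r : bool) :
  (0 < k)%N -> configurations z -> (forall e, G e != inr (~~ r)) ->
  ddensity G z = 0.
Proof.
case: k G z => // k G z _ [zpos _] nG.
(* The generator of the dilations centred at [r]. Its entry at [(ord0, true)] is a height, so this
   kernel vector is nonzero. *)
pose xi (c : 'I_k.+1 * bool) : R :=
  if c.2 then (tnth z c.1).2 else (tnth z c.1).1 - r%:R.
apply: (@det_eq0_ker _ _ (fun e c => dangle G e z (unit_displacement R c)) xi (ord0, true)).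
  by rewrite /xi /= gt_eqF.
move=> e; rewrite dangle_sum /dangle /im_quot /xi.
(* The only boundary target allowed is the centre [r], which the dilations fix. *)
have rE : displacement (fun i => ((tnth z i).1 - r%:R, (tnth z i).2)) (G e) =
    ((point z (G e)).1 - r%:R, (point z (G e)).2).
  case E : (G e) => [i|s] //=; have := nG e; rewrite E => nE.
  have -> : s = r by case: (s) (r) nE => [] [].
  by rewrite subrr.
by rewrite /= rE /=; set D := (_ + _)^-1; set D' := (_ + _)^-1; ring.
Qed.

(** The angle of an edge does not vary when points of the other component move, so the matrix is
    block diagonal. *)
Lemma ddensity_merge k1 k2 k (h : 'I_k1 + 'I_k2 -> 'I_k) hinv
    (hK : cancel h hinv) (hinvK : cancel hinv h)
    (G : graph k) (G1 : graph k1) (G2 : graph k2) :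
  (forall v b, G (h (inl v), b) =
     match G1 (v, b) with inl w => inl (h (inl w)) | inr s => inr s end) ->
  (forall v b, G (h (inr v), b) =
     match G2 (v, b) with inl w => inl (h (inr w)) | inr s => inr s end) ->
  forall z1 z2 , ddensity G (merge hinv z1 z2) = ddensity G1 z1 * ddensity G2 z2 :> R.
Proof.
move=> hG1 hG2 z1 z2.
pose h1 (e : edge k1) : edge k := (h (inl e.1), e.2).
pose h2 (e : edge k2) : edge k := (h (inr e.1), e.2).
pose hi (e : edge k) : edge k1 + edge k2 :=
  match hinv e.1 with inl v => inl (v, e.2) | inr v => inr (v, e.2) end.
have hi_can1 : cancel (fun s => match s with inl x => h1 x | inr y => h2 y end) hi.
  by case=> -[v b]; rewrite /hi /= hK.
have hi_can2 : cancel hi (fun s => match s with inl x => h1 x | inr y => h2 y end).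
  by move=> [v b]; rewrite /hi /= -{2}(hinvK v); case: (hinv v).
have z1E v : tnth (merge hinv z1 z2) (h (inl v)) = tnth z1 v.
  by rewrite tnth_mktuple hK.
have z2E v : tnth (merge hinv z1 z2) (h (inr v)) = tnth z2 v.
  by rewrite tnth_mktuple hK.
have hinj := can_inj hK.
rewrite /ddensity (det_block_diag (f := fun e c =>
    dangle G e (merge hinv z1 z2) (unit_displacement R c)) hi_can1 hi_can2).
- congr (_ * _); congr (\det _); apply/matrixP => i j; rewrite !mxE.
    case: (enum_val i) (enum_val j) => v b [w c].
    rewrite /dangle /h1 /= hG1 z1E /unit_displacement /= (inj_eq hinj).
    case: (G1 (v, b)) => [x|s] //=.
    by rewrite z1E (inj_eq hinj).
  case: (enum_val i) (enum_val j) => v b [w c].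
  rewrite /dangle /h2 /= hG2 z2E /unit_displacement /= (inj_eq hinj).
  case: (G2 (v, b)) => [x|s] //=.
  by rewrite z2E (inj_eq hinj).
- move=> [w c] [v b]; rewrite /dangle /h1 /h2 /= hG2 /unit_displacement /= (inj_eq hinj) /=.
  by case: (G2 (v, b)) => [x|s] /=; rewrite ?(inj_eq hinj) /im_quot /=; ring.
Qed.

End Density.

(** * Measurability, vanishing and multiplicativity of the weights *)

Section Weight.
Context (R : realType).
Local Open Scope classical_set_scope.
Local Notation conf k := (k.-tuple (plane R)).

Lemma measurable_invr : measurable_fun [set: R] (fun x : R => x^-1).
Proof.
have cE : [set: R] = [set x | x != 0] `|` [set 0].
  by apply/seteqP; split => // x _; case: (eqVneq x 0) => [->|]; [right|left].
have oE : open [set x : R | x != 0].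
  rewrite (_ : [set x | x != 0] = ~` [set 0]).
    by rewrite openC; exact: closed_eq.
  by apply/seteqP; split => x /= /eqP.
rewrite cE; apply/measurable_funU.
- exact: open_measurable.
- exact: measurable_set1.
split; last exact: measurable_fun_set1.
apply: open_continuous_measurable_fun => // x; rewrite inE /= => x0.
exact: inv_continuous.
Qed.

Lemma measurable_det d (T : measurableType d) m (f : 'I_m -> 'I_m -> T -> R) :
  (forall i j, measurable_fun setT (f i j)) ->
  measurable_fun setT (fun z => \det (\matrix_(i, j) f i j z)).
Proof.
move=> mf.
rewrite (_ : (fun z => _) = fun z => \sum_(s : 'S_m) (-1) ^+ s * \prod_i f i (s i) z).
  apply: measurable_sum => s; apply: measurable_funM => //.
  by apply: measurable_prod => i _.
apply/funext => z; apply: eq_bigr => s _; congr (_ * _).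
by apply: eq_bigr => i _; rewrite mxE.
Qed.

Lemma measurable_point k w :
  measurable_fun setT (fun z : conf k => (point z w).1 : R) /\
  measurable_fun setT (fun z : conf k => (point z w).2 : R).
Proof.
case: w => [i|s] /=; last by split.
by split; apply: measurableT_comp => //; exact: measurable_tnth.
Qed.

Lemma measurable_im_quot d (T : measurableType d) (a b : R) (f g : T -> R) :
  measurable_fun setT f -> measurable_fun setT g ->
  measurable_fun setT (fun z => im_quot a b (f z) (g z)).
Proof.
move=> mf mg; apply: measurable_funM.
  by apply: measurable_funB; apply: measurable_funM.
apply: (measurableT_comp measurable_invr).
by apply: measurable_funD; apply: measurable_funX.
Qed.

Lemma measurable_ddensity k (G : graph k) :
  measurable_fun setT (@ddensity R k G).
Proof.
apply: measurable_det => i j.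
have [mv1 mv2] := measurable_point (inl (enum_val i).1).
have [mw1 mw2] := measurable_point (G (enum_val i)).
by apply: measurable_funB; apply: measurable_im_quot;
  [apply: measurable_funB..|apply: measurable_funB|apply: measurable_funD].
Qed.

Lemma measurable_configurations k :
  measurable (@configurations R k : set (conf k)).
Proof.
pose P (i j : 'I_k) : set (conf k) := [set z | (0 < (tnth z i).2) /\
  (i != j -> ((tnth z i).1 != (tnth z j).1) \/ ((tnth z i).2 != (tnth z j).2))].
have -> : @configurations R k = \bigcap_i \bigcap_j P i j.
  apply/seteqP; split => z.
    move=> [zpos zinj] i _ j _; split => // /eqP ij.
    apply/orP; rewrite -negb_and -xpair_eqE -!surjective_pairing.
    by apply/eqP => /zinj.
  move=> H; split => [i|i j zij]; first by case: (H i I i I).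
  apply/eqP/negPn/negP => ij; have [_ /(_ ij)] := H i I j I.
  by rewrite zij !eqxx; case.
apply: fin_bigcap_measurable => // i _; apply: fin_bigcap_measurable => // j _.
have [m1 m2] := @measurable_point k (inl i).
have [n1 n2] := @measurable_point k (inl j).
apply: measurableI.
  by have := measurable_fun_ltr (measurable_cst (0 : R)) m2 measurableT (Y := [set true]) I;
    rewrite setTI.
have [->|ij] := eqVneq i j.
  by rewrite [X in measurable X](_ : _ = setT) //; apply/seteqP; split.
rewrite [X in measurable X](_ : _ = ~` ([set z | (tnth z i).1 == (tnth z j).1] `&`
                               [set z | (tnth z i).2 == (tnth z j).2])).
  apply: measurableC; apply: measurableI.
    by have := measurable_fun_eqr m1 n1 measurableT (Y := [set true]) I; rewrite setTI.
  by have := measurable_fun_eqr m2 n2 measurableT (Y := [set true]) I; rewrite setTI.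
apply/seteqP; split => z /=.
  by move=> /(_ isT) + [e1 e2]; rewrite e1 e2; case.
by move=> /not_andP + _ => -[]/negP; [left|right].
Qed.

(** The indicator turns the integral over configurations into one over the whole space, where
    [fine_integral_merge] applies. *)
Definition cfg_density k (G : graph k) (z : conf k) : R :=
  ddensity G z * \1_(@configurations R k) z.

Lemma measurable_cfg_density k (G : graph k) :
  measurable_fun setT (@cfg_density k G).
Proof.
apply: measurable_funM; first exact: measurable_ddensity.
by apply: measurable_indic; exact: measurable_configurations.
Qed.

Lemma weightE k (G : graph k) : admissible G ->
  weight R G = (2 ^+ k * (2 * pi) ^+ (2 * k))^-1 *
    fine (\int[@cfg_measure R k]_z (cfg_density G z)%:E).
Proof.
move=> aG; congr (_ * fine _).
rewrite cfg_measureE integral_mkcond; apply: eq_integral => z _.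
rewrite patchE /cfg_density indicE; case: ifPn => zC; last by rewrite mulr0.
by rewrite mulr1 weight_densityE //; exact: set_mem.
Qed.

Lemma weight_eq0 k (G : graph k) (r : bool) : (0 < k)%N -> admissible G ->
  (forall e, G e != inr (~~ r)) -> weight R G = 0.
Proof.
move=> k0 aG nG; rewrite weightE // cfg_measureE integral0_eq ?mulr0 // => z _.
rewrite /cfg_density indicE; have [zC|] := boolP (z \in _); last by rewrite mulr0.
by rewrite (ddensity_eq0 k0 (set_mem zC) nG) mul0r.
Qed.

(** An empty determinant is integrated over a one-point space of mass 1. *)
Lemma weight0 (G : graph 0) : weight R G = 1.
Proof.
rewrite /weight !expr0 mulr1 invr1 mul1r cfg_measureE.
rewrite (_ : (fun z => _) = cst 1%E).
  rewrite integral_cst; last exact: measurable_configurations.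
  rewrite mul1e (_ : @configurations R 0 = box (fun=> [set: plane R])).
    by rewrite [X in fine X](@cfg_sigma_measure_box R 0 (fun=> setT)) ?big_ord0.
  by apply/seteqP; split => z // _; split => -[].
apply/funext => z; congr (_%:E).
rewrite /weight_density -[RHS](det1 R 0).
rewrite (@det_reindex R (edge 0)
  (fun e c => darg (fun t => angle_ratio G e (Defs.shift z c t))) 0 (fun i => (i, true))).
  by congr (\det _); apply/matrixP => -[].
by exists fst => [i|[[]]].
Qed.

(** The normalising constant is multiplicative in [k = k1 + k2], and density and domain factorise
    where no abscissas coincide. *)
Lemma weight_merge k1 k2 k (h : 'I_k1 + 'I_k2 -> 'I_k) hinv
    (hK : cancel h hinv) (hinvK : cancel hinv h)
    (G : graph k) (G1 : graph k1) (G2 : graph k2) :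
  admissible G -> admissible G1 -> admissible G2 ->
  (forall v b, G (h (inl v), b) =
     match G1 (v, b) with inl w => inl (h (inl w)) | inr s => inr s end) ->
  (forall v b, G (h (inr v), b) =
     match G2 (v, b) with inl w => inl (h (inr w)) | inr s => inr s end) ->
  weight R G = weight R G1 * weight R G2.
Proof.
move=> aG aG1 aG2 hG1 hG2; rewrite !weightE //.
have kE : k = (k1 + k2)%N.
  by rewrite -(card_ord k) -(bij_eq_card (Bijective hK hinvK)) card_sum !card_ord.
rewrite (@fine_integral_merge R k1 k2 k h hinv hK hinvK (cfg_density G)
  (cfg_density G1) (cfg_density G2)); try exact: measurable_cfg_density.
  by rewrite kE mulnDr !exprD !invfM; ring.
move=> z1 z2 z12.
rewrite /cfg_density (ddensity_merge hK hinvK hG1 hG2) !indicE.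
(* Points of different parts have different abscissas, so merging creates no coincidence. *)
suff -> : (merge hinv z1 z2 \in @configurations R k) =
  (z1 \in @configurations R k1) && (z2 \in @configurations R k2).
  by rewrite -mulnb natrM; ring.
have mE s : tnth (merge hinv z1 z2) (h s) =
    match s with inl v => tnth z1 v | inr v => tnth z2 v end.
  by rewrite tnth_mktuple hK.
apply/idP/andP => [/set_mem[zpos zinj]|[/set_mem[pos1 inj1] /set_mem[pos2 inj2]]].
  split; apply/mem_set; split => [i|i j e].
  - by have := zpos (h (inl i)); rewrite mE.
  - by have := zinj (h (inl i)) (h (inl j)); rewrite !mE => /(_ e) /(can_inj hK)[].
  - by have := zpos (h (inr i)); rewrite mE.
  - by have := zinj (h (inr i)) (h (inr j)); rewrite !mE => /(_ e) /(can_inj hK)[].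
apply/mem_set; split => [i|i j].
  by rewrite -(hinvK i) mE; case: (hinv i).
rewrite -(hinvK i) -(hinvK j) !mE.
case: (hinv i) (hinv j) => x [] y e.
- by rewrite (inj1 _ _ e).
- by have := z12 x y; rewrite e eqxx.
- by have := z12 y x; rewrite e eqxx.
- by rewrite (inj2 _ _ e).
Qed.

End Weight.

(** * Gluing graphs *)

Section DerivativeSums.
Context (R : comNzRingType) (N : nat) (T : finType) (I : T -> 'I_N).
Implicit Types (f g : {mpoly R[N]}) (P : pred T).

Lemma mderivm_sumU_eq0 P f e : P e -> f^`M(I e) = 0 ->
  f^`M[(\sum_(e | P e) U_(I e))%MM] = 0.
Proof. by move=> Pe fe; rewrite (bigD1 e) //= mderivmDm mderivmU1m fe raddf0. Qed.

Lemma mderivm_sumUMl P f g : (forall e, P e -> g^`M(I e) = 0) ->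
  (f * g)^`M[(\sum_(e | P e) U_(I e))%MM] =
  f^`M[(\sum_(e | P e) U_(I e))%MM] * g.
Proof.
move=> gP; elim: (index_enum T) f => [|e r IH] f.
  by rewrite !big_nil !mderivm0m.
rewrite !big_cons; case: ifP => Pe //.
by rewrite !mderivmDm !mderivmU1m mderivM gP // mulr0 addr0 IH.
Qed.

End DerivativeSums.

(** * Bidifferential operators with edge labels restricted to a colour *)

Section TwoColours.
Context (R : realType) (N : nat) (pi_ : 'M[{mpoly R[N]}]_N).
Implicit Types (f g : {mpoly R[N]}) (x c : pred 'I_N).

Definition graph_term k (G : graph k) (I : {ffun edge k -> 'I_N}) f g :=
  (\prod_(v < k) (pi_ (I (v, false)) (I (v, true)))^`M[diff_at G I (inl v)]) *
  f^`M[diff_at G I (inr false)] * g^`M[diff_at G I (inr true)].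

(* [k! B_k], restricted to the labellings of the edges by indices in [x]. *)
Definition Bpart x k f g : {mpoly R[N]} :=
  \sum_(G : graph k | admissible G)
    weight R G *: \sum_(I : {ffun edge k -> 'I_N} | [forall e, x (I e)]) graph_term G I f g.

Lemma B_Bpart k f g : B pi_ k f g = (k`!)%:R^-1 *: Bpart predT k f g.
Proof.
rewrite /B scaler_sumr; apply: eq_bigr => G _; rewrite scalerA mulrC.
congr (_ *: _); apply: eq_bigl => I; apply/esym/forallP => e //.
Qed.

Lemma Bpart0 x f g : Bpart x 0 f g = f * g.
Proof.
have E (s : edge 0) : False by case: s => -[].
have gE (G G' : graph 0) : G = G' by apply/ffunP => s; case: (E s).
rewrite /Bpart (big_pred1 [ffun=> inr false]) => [|G]; last first.
  by rewrite /= (gE G [ffun=> inr false]) eqxx; apply/forallP => -[].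
rewrite weight0 scale1r.
have iE (I I' : {ffun edge 0 -> 'I_N}) : I = I' by apply/ffunP => s; case: (E s).
have I0 : {ffun edge 0 -> 'I_N} by apply: finfun => s; case: (E s).
rewrite (big_pred1 I0) => [|I]; last first.
  by rewrite /= (iE I I0) eqxx; apply/forallP => s; case: (E s).
rewrite /graph_term big_ord0 mul1r /diff_at.
by rewrite !big_pred0 ?mderivm0m // => s; case: (E s).
Qed.

(** An edge into [L] differentiates the constant 1; a graph without such an edge has weight 0 by
    dilation invariance. *)
Lemma Bpart_1l x k g : (0 < k)%N -> Bpart x k 1 g = 0.
Proof.
move=> k0; rewrite /Bpart big1 // => G aG.
have [/existsP[e /eqP Ge]|/existsPn nG] := boolP [exists e, G e == inr false].
  rewrite big1 ?scaler0 // => I _; rewrite /graph_term.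
  rewrite [X in _ * X * _](@mderivm_sumU_eq0 _ _ _ _ _ _ e) ?mulr0 ?mul0r //.
    exact/eqP.
  by rewrite -mpolyC1 mderivC.
by rewrite (@weight_eq0 _ _ _ true) // scale0r.
Qed.

Lemma Bpart_1r x k f : (0 < k)%N -> Bpart x k f 1 = 0.
Proof.
move=> k0; rewrite /Bpart big1 // => G aG.
have [/existsP[e /eqP Ge]|/existsPn nG] := boolP [exists e, G e == inr true].
  rewrite big1 ?scaler0 // => I _; rewrite /graph_term.
  rewrite [X in _ * X](@mderivm_sumU_eq0 _ _ _ _ _ _ e) ?mulr0 //.
    exact/eqP.
  by rewrite -mpolyC1 mderivC.
by rewrite (@weight_eq0 _ _ _ false) // scale0r.
Qed.

Lemma Bpart_1 x k : Bpart x k 1 1 = (k == 0)%:R.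
Proof. by case: k => [|k]; rewrite ?Bpart0 ?mulr1 // Bpart_1l. Qed.

(** Independence of the variables outside [x] is expressed by derivatives, the form in which the
    graph terms exploit it. *)
Definition depends_on x f := forall l, ~~ x l -> f^`M(l) = 0.

Lemma depends_on_mderiv x f l : depends_on x f -> depends_on x f^`M(l).
Proof. by move=> xf j xj; rewrite mderiv_comm xf // mderiv0. Qed.

Lemma depends_on_mderivm x f m : depends_on x f -> depends_on x f^`M[m].
Proof.
move=> xf; rewrite /mderivm; elim: (enum _) => //= l s IH.
by elim: (m l) => //= j; exact: depends_on_mderiv.
Qed.

Lemma depends_on1 x : depends_on x 1.
Proof. by move=> l _; rewrite -mpolyC1 mderivC. Qed.

Section Glue.
Context (k1 k2 k : nat) (h : 'I_k1 + 'I_k2 -> 'I_k) (hinv : 'I_k -> 'I_k1 + 'I_k2).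
Hypotheses (hK : cancel h hinv) (hinvK : cancel hinv h).

Definition glue_graph (G : graph k1 * graph k2) : graph k :=
  [ffun e => match hinv e.1 with
   | inl v => match G.1 (v, e.2) with inl w => inl (h (inl w)) | inr s => inr s end
   | inr v => match G.2 (v, e.2) with inl w => inl (h (inr w)) | inr s => inr s end
   end].

(** The default [inr false] replaces a target in the other part, a case that [compatible]
    excludes. *)
Definition split_graph (G : graph k) : graph k1 * graph k2 :=
  ([ffun e => match G (h (inl e.1), e.2) with
    | inl w => if hinv w is inl w' then inl w' else inr false
    | inr s => inr s end],
   [ffun e => match G (h (inr e.1), e.2) with
    | inl w => if hinv w is inr w' then inl w' else inr false
    | inr s => inr s end]).

Definition glue_label (I : {ffun edge k1 -> 'I_N} * {ffun edge k2 -> 'I_N}) :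
    {ffun edge k -> 'I_N} :=
  [ffun e => match hinv e.1 with inl v => I.1 (v, e.2) | inr v => I.2 (v, e.2) end].

Definition split_label (I : {ffun edge k -> 'I_N}) :
    {ffun edge k1 -> 'I_N} * {ffun edge k2 -> 'I_N} :=
  ([ffun e => I (h (inl e.1), e.2)], [ffun e => I (h (inr e.1), e.2)]).

Definition left_vertex (v : 'I_k) : bool := if hinv v is inl _ then true else false.

(** Characterises the image of [glue_graph]. *)
Definition compatible (G : graph k) : bool :=
  [forall e, if G e is inl w then left_vertex w == left_vertex e.1 else true].

Lemma glue_labelK : cancel glue_label split_label.
Proof.
by move=> [I1 I2]; congr pair; apply/ffunP => -[v b]; rewrite !ffunE /= hK.
Qed.

Lemma split_labelK : cancel split_label glue_label.
Proof.
move=> I; apply/ffunP => -[v b]; rewrite !ffunE /=.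
by rewrite -{2}(hinvK v); case: (hinv v) => w; rewrite ffunE.
Qed.

Lemma glue_graphK : cancel glue_graph split_graph.
Proof.
move=> [G1 G2]; congr pair; apply/ffunP => -[v b]; rewrite !ffunE /= hK.
  by case: (G1 _) => // w; rewrite hK.
by case: (G2 _) => // w; rewrite hK.
Qed.

Lemma split_graphK G : compatible G -> glue_graph (split_graph G) = G.
Proof.
move=> /forallP cG; apply/ffunP => -[v b]; rewrite ffunE /=.
rewrite -{2}(hinvK v); have := cG (v, b); rewrite /left_vertex /=.
case Ev : (hinv v) => [u|u]; rewrite ffunE /= -Ev hinvK.
  by case: (G (v, b)) => // w; case Ew : (hinv w) => [w'|w'] //= _; rewrite -Ew hinvK.
by case: (G (v, b)) => // w; case Ew : (hinv w) => [w'|w'] //= _; rewrite -Ew hinvK.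
Qed.

Lemma glue_graph_compatible G : compatible (glue_graph G).
Proof.
apply/forallP => -[v b]; rewrite ffunE /= /left_vertex.
by case: (hinv v) => u; [case: (G.1 _)|case: (G.2 _)] => // w; rewrite hK.
Qed.

Lemma admissible_glue G :
  admissible (glue_graph G) = admissible G.1 && admissible G.2.
Proof.
have hinj := can_inj hK.
case: G => G1 G2 /=; apply/forallP/andP => [H|[/forallP H1 /forallP H2] v].
  split; apply/forallP => v; [have := H (h (inl v))|have := H (h (inr v))];
  rewrite !ffunE /= hK; [case: (G1 _) (G1 _)|case: (G2 _) (G2 _)] => w [w'|s] //;
  by rewrite ?(inj_eq (@inl_inj _ _), inj_eq hinj) //= ?(inj_eq (@inl_inj _ _), inj_eq (@inr_inj _ _)).
rewrite !ffunE /= -(hinvK v) hK; case: (hinv v) => u; [have := H1 u|have := H2 u];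
[case: (G1 _) (G1 _)|case: (G2 _) (G2 _)] => w [w'|s] //;
by rewrite ?(inj_eq (@inl_inj _ _), inj_eq hinj) //= ?(inj_eq (@inl_inj _ _), inj_eq (@inr_inj _ _)).
Qed.

End Glue.

End TwoColours.

(** * Factorisation of the terms of a disjoint union of graphs *)

Section GlueTerm.
Context (R : realType) (N : nat) (pi_ : 'M[{mpoly R[N]}]_N).
Implicit Types (f g : {mpoly R[N]}).
Context (k1 k2 k : nat) (h : 'I_k1 + 'I_k2 -> 'I_k) (hinv : 'I_k -> 'I_k1 + 'I_k2).
Hypotheses (hK : cancel h hinv) (hinvK : cancel hinv h).
Let hinj := can_inj hK.
Let iE := (inj_eq (@inl_inj 'I_k bool), inj_eq (@inl_inj 'I_k1 bool),
           inj_eq (@inl_inj 'I_k2 bool), inj_eq (@inr_inj 'I_k bool),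
           inj_eq (@inr_inj 'I_k1 bool), inj_eq (@inr_inj 'I_k2 bool), inj_eq hinj,
           inj_eq (@inl_inj 'I_k1 'I_k2), inj_eq (@inr_inj 'I_k1 'I_k2)).

Local Notation glueG := (glue_graph h hinv).
Local Notation glueI := (glue_label hinv).

Lemma big_glue_edges (T : Type) (idx : T) (op : Monoid.com_law idx)
    (P : pred (edge k)) (F : edge k -> T) :
  \big[op/idx]_(e | P e) F e =
  op (\big[op/idx]_(e : edge k1 | P (h (inl e.1), e.2)) F (h (inl e.1), e.2))
     (\big[op/idx]_(e : edge k2 | P (h (inr e.1), e.2)) F (h (inr e.1), e.2)).
Proof.
pose he (s : edge k1 + edge k2) : edge k :=
  match s with inl e => (h (inl e.1), e.2) | inr e => (h (inr e.1), e.2) end.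
rewrite (reindex he) ?big_sumType //=.
exists (fun e => match hinv e.1 with inl v => inl (v, e.2) | inr v => inr (v, e.2) end).
  by move=> [[v b]|[v b]] _ /=; rewrite hK.
by move=> [v b] _ /=; rewrite -{2}(hinvK v); case: (hinv v).
Qed.

Lemma glue_graphl G v b : glueG G (h (inl v), b) =
  match G.1 (v, b) with inl w => inl (h (inl w)) | inr s => inr s end.
Proof. by rewrite ffunE /= hK. Qed.

Lemma glue_graphr G v b : glueG G (h (inr v), b) =
  match G.2 (v, b) with inl w => inl (h (inr w)) | inr s => inr s end.
Proof. by rewrite ffunE /= hK. Qed.

Lemma glue_labell (I : {ffun edge k1 -> 'I_N} * {ffun edge k2 -> 'I_N}) v b :
  glueI I (h (inl v), b) = I.1 (v, b).
Proof. by rewrite ffunE /= hK. Qed.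

Lemma glue_labelr (I : {ffun edge k1 -> 'I_N} * {ffun edge k2 -> 'I_N}) v b :
  glueI I (h (inr v), b) = I.2 (v, b).
Proof. by rewrite ffunE /= hK. Qed.

(** An inner vertex receives edges from its own part only, whereas [L] and [R] collect edges from
    both. *)
Lemma diff_at_glue G (I : {ffun edge k1 -> 'I_N} * {ffun edge k2 -> 'I_N})
    (w : vertex k) : diff_at (glueG G) (glueI I) w =
  match w with
  | inl v => match hinv v with
             | inl v1 => diff_at G.1 I.1 (inl v1)
             | inr v2 => diff_at G.2 I.2 (inl v2) end
  | inr s => (diff_at G.1 I.1 (inr s) + diff_at G.2 I.2 (inr s))%MM
  end.
Proof.
have E1 : (\sum_(e : edge k1 | glueG G (h (inl e.1), e.2) == w)
      U_(glueI I (h (inl e.1), e.2)))%MM =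
    (\sum_(e : edge k1 | match G.1 e with inl u => inl (h (inl u)) | inr s => inr s end == w)
      U_(I.1 e))%MM.
  by apply: eq_big => [[v b]|[v b] _]; rewrite ?glue_graphl ?glue_labell.
have E2 : (\sum_(e : edge k2 | glueG G (h (inr e.1), e.2) == w)
      U_(glueI I (h (inr e.1), e.2)))%MM =
    (\sum_(e : edge k2 | match G.2 e with inl u => inl (h (inr u)) | inr s => inr s end == w)
      U_(I.2 e))%MM.
  by apply: eq_big => [[v b]|[v b] _]; rewrite ?glue_graphr ?glue_labelr.
rewrite /diff_at big_glue_edges E1 E2 /= {E1 E2}.
case: w => [v|s]; last first.
  by congr (_ + _)%MM; apply: eq_bigl => e; [case: (G.1 _)|case: (G.2 _)].
rewrite -{1 2}(hinvK v); case: (hinv v) => u.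
  rewrite [X in (_ + X)%MM]big_pred0 => [|e]; last first.
    by case: (G.2 _) => // w; rewrite !iE.
  by rewrite addm0; apply: eq_bigl => e; case: (G.1 _) => // w; rewrite !iE.
rewrite [X in (X + _)%MM]big_pred0 => [|e]; last first.
  by case: (G.1 _) => // w; rewrite !iE.
by rewrite add0m; apply: eq_bigl => e; case: (G.2 _) => // w; rewrite !iE.
Qed.

(** At [L] and [R] the derivatives of each colour pass through the factor of the other colour, which
    is constant for them. *)
Lemma graph_term_glue (c : pred 'I_N) G
    (I : {ffun edge k1 -> 'I_N} * {ffun edge k2 -> 'I_N}) f1 f2 g1 g2 :
  (forall e, c (I.1 e)) -> (forall e, ~~ c (I.2 e)) ->
  depends_on c f1 -> depends_on (predC c) f2 ->
  depends_on c g1 -> depends_on (predC c) g2 ->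
  graph_term pi_ (glueG G) (glueI I) (f1 * f2) (g1 * g2) =
  graph_term pi_ G.1 I.1 f1 g1 * graph_term pi_ G.2 I.2 f2 g2.
Proof.
move=> cI1 cI2 cf1 cf2 cg1 cg2.
have splitE u1 u2 (s : bool) : depends_on c u1 -> depends_on (predC c) u2 ->
    (u1 * u2)^`M[diff_at (glueG G) (glueI I) (inr s)] =
    u1^`M[diff_at G.1 I.1 (inr s)] * u2^`M[diff_at G.2 I.2 (inr s)].
  move=> cu1 cu2; rewrite diff_at_glue mderivmDm mderivm_sumUMl; last first.
    by move=> e _; rewrite cu2 //= negbK.
  rewrite mulrC mderivm_sumUMl 1?mulrC // => e _.
  by apply: depends_on_mderivm => //; exact: cu1.
rewrite /graph_term !splitE //.
rewrite (reindex h) /=; last by exists hinv => ? _.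
rewrite big_sumType /=.
rewrite (eq_bigr (fun v => (pi_ (I.1 (v, false)) (I.1 (v, true)))^`M[diff_at G.1 I.1 (inl v)]));
  last by move=> v _; rewrite !glue_labell diff_at_glue hK.
rewrite [X in _ * X * _ * _](eq_bigr (fun v =>
    (pi_ (I.2 (v, false)) (I.2 (v, true)))^`M[diff_at G.2 I.2 (inl v)]));
  last by move=> v _; rewrite !glue_labelr diff_at_glue hK.
ring.
Qed.

Local Notation coloured c I :=
  [forall e, c (fun_of_fin I e) == left_vertex hinv e.1].

(** An edge between the two parts differentiates the entry of [pi_] at its target by a variable of
    the other colour. *)
Lemma graph_term_eq0 (c : pred 'I_N) (G : graph k) (I : {ffun edge k -> 'I_N}) f g :
  (forall i j l, c i = c j -> c l != c i -> (pi_ i j)^`M(l) = 0) ->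
  coloured c I -> ~~ compatible hinv G -> graph_term pi_ G I f g = 0.
Proof.
move=> pi_c /forallP cI /forallPn[e]; case Ge : (G e) => [w|] // we.
rewrite /graph_term (bigD1 w) //= (@mderivm_sumU_eq0 _ _ _ _ _ _ e) ?mul0r ?Ge //.
have cE b : c (I (w, b)) = left_vertex hinv w by exact/eqP/cI.
by apply: pi_c; rewrite !cE // (eqP (cI e)) eq_sym.
Qed.

(** Only compatible graphs survive; they are the glued ones, whose weights and terms are
    products. *)
Lemma sum_glue (c : pred 'I_N) f1 f2 g1 g2 :
  (forall i j l, c i = c j -> c l != c i -> (pi_ i j)^`M(l) = 0) ->
  depends_on c f1 -> depends_on (predC c) f2 ->
  depends_on c g1 -> depends_on (predC c) g2 ->
  \sum_(G : graph k | admissible G) weight R G *: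
     \sum_(I : {ffun edge k -> 'I_N} | coloured c I) graph_term pi_ G I (f1 * f2) (g1 * g2) =
  Bpart pi_ c k1 f1 g1 * Bpart pi_ (predC c) k2 f2 g2.
Proof.
move=> pi_c cf1 cf2 cg1 cg2.
rewrite (bigID (compatible hinv)) /= [X in _ + X]big1 ?addr0; last first.
  move=> G /andP[_ nG]; rewrite big1 ?scaler0 // => I cI.
  exact: (graph_term_eq0 _ _ pi_c cI nG).
rewrite (reindex_onto glueG (split_graph h hinv)) /=; last first.
  by move=> G /andP[_ cG]; exact: split_graphK.
rewrite (eq_bigl (fun G : graph k1 * graph k2 => admissible G.1 && admissible G.2)); last first.
  by move=> G; rewrite admissible_glue // glue_graph_compatible // glue_graphK // eqxx !andbT.
rewrite /Bpart big_distrlr pair_big /=; apply: eq_bigr => -[G1 G2] /= /andP[aG1 aG2].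
have aG : admissible (glueG (G1, G2)) by rewrite admissible_glue //= aG1.
rewrite (weight_merge R hK hinvK aG aG1 aG2); last 2 first.
- by move=> v b; rewrite glue_graphl.
- by move=> v b; rewrite glue_graphr.
rewrite -[RHS]scalerAl -[X in _ = _ *: X]scalerAr [RHS]scalerA; congr (_ *: _).
rewrite (reindex (glue_label hinv)) /=; last first.
  by exists (split_label h) => I _; [exact: glue_labelK|exact: split_labelK].
rewrite big_distrlr pair_big /=.
apply: eq_big => [[I1 I2]|[I1 I2]] /=.
  apply/forallP/andP => [H|[/forallP H1 /forallP H2] [v b]].
    split; apply/forallP => -[v b] /=.
      by have := H (h (inl v), b); rewrite glue_labell /left_vertex /= hK => /eqP.
    by have := H (h (inr v), b); rewrite glue_labelr /left_vertex /= hK => /eqP ->.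
  rewrite -(hinvK v); case: (hinv v) => u; rewrite /left_vertex /= hK.
    by rewrite glue_labell /= H1.
  by rewrite glue_labelr /=; have /= /negPf -> := H2 (u, b).
move=> /forallP H.
have cv s b : c (glueI (I1, I2) (h s, b)) = if s is inl _ then true else false.
  by have /eqP := H (h s, b); rewrite /left_vertex /= hK.
apply: (@graph_term_glue c) => // -[v b] /=.
  by have := cv (inl v) b; rewrite glue_labell.
by have := cv (inr v) b; rewrite glue_labelr => ->.
Qed.

End GlueTerm.

(** * Convolution formula for two independent groups of variables *)

Section Convolution.
Context (R : realType) (N : nat) (pi_ : 'M[{mpoly R[N]}]_N).
Implicit Types (f g : {mpoly R[N]}) (c : pred 'I_N).

(** [pi_] is block diagonal for the two colours, and each block only involves its own variables. *)
Definition separates c :=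
  (forall i j, c i != c j -> pi_ i j = 0) /\
  (forall i j l, c i = c j -> c l != c i -> (pi_ i j)^`M(l) = 0).

Lemma separatesC c : separates c -> separates (predC c).
Proof.
move=> [s1 s2]; split => [i j|i j l] /=; rewrite (inj_eq negb_inj); first exact: s1.
by move/negb_inj; exact: s2.
Qed.

Lemma subset_split k (A : {set 'I_k}) :
  exists (h : 'I_#|A| + 'I_#|~: A| -> 'I_k) (hinv : 'I_k -> 'I_#|A| + 'I_#|~: A|),
  [/\ cancel h hinv, cancel hinv h & forall v, left_vertex hinv v = (v \in A)].
Proof.
pose h (s : 'I_#|A| + 'I_#|~: A|) : 'I_k :=
  match s with inl i => enum_val i | inr i => enum_val i end.
have hA s : (h s \in A) = if s is inl _ then true else false.
  case: s => i /=; first exact: enum_valP.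
  by have := enum_valP i; rewrite inE => /negPf.
have h_inj : injective h.
  move=> s t e; have := hA t; rewrite -e hA.
  by case: s t e => i [] j //= /enum_val_inj ->.
have [hinv hK hinvK] : bijective h.
  by apply: inj_card_bij => //; rewrite card_sum !card_ord cardsC card_ord.
exists h, hinv; split => // v.
by rewrite /left_vertex -{2}(hinvK v) hA.
Qed.

(** In a nonzero term the two edges leaving a vertex have the same colour; [A] is the set of
    vertices of colour [c]. *)
Lemma Bpart_split c k f1 f2 g1 g2 : separates c ->
  depends_on c f1 -> depends_on (predC c) f2 ->
  depends_on c g1 -> depends_on (predC c) g2 ->
  Bpart pi_ predT k (f1 * f2) (g1 * g2) =
  \sum_(A : {set 'I_k}) Bpart pi_ c #|A| f1 g1 * Bpart pi_ (predC c) #|~: A| f2 g2.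
Proof.
move=> [pi_off pi_c] cf1 cf2 cg1 cg2.
transitivity (\sum_(A : {set 'I_k}) \sum_(G : graph k | admissible G) weight R G *:
   \sum_(I : {ffun edge k -> 'I_N} | [forall e, c (I e) == (e.1 \in A)])
     graph_term pi_ G I (f1 * f2) (g1 * g2)); last first.
  apply: eq_bigr => A _; have [h [hinv [hK hinvK hA]]] := subset_split A.
  rewrite -(sum_glue hK hinvK pi_c cf1 cf2 cg1 cg2).
  apply: eq_bigr => G _; congr (_ *: _); apply: eq_bigl => I.
  by apply: eq_forallb => e; rewrite hA.
rewrite exchange_big /=; apply: eq_bigr => G _; rewrite -scaler_sumr; congr (_ *: _).
(* [A] is read off the first edges; a second edge that disagrees makes the factor [pi_ i j]
   vanish. *)
rewrite (partition_big (fun I : {ffun edge k -> 'I_N} => [set v | c (I (v, false))]) predT) //=.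
apply: eq_bigr => A _.
rewrite [LHS](bigID (fun I : {ffun edge k -> 'I_N} => [forall e, c (I e) == (e.1 \in A)])) /=.
rewrite [X in _ + X]big1 ?addr0; last first.
  move=> I /andP[/andP[_ /eqP IA] /forallPn[[v b] /= cIv]].
  have cv : c (I (v, false)) = (v \in A) by rewrite -IA inE.
  case: b cIv => [cIv|]; last by rewrite cv eqxx.
  rewrite /graph_term (bigD1 v) //= pi_off ?raddf0 ?mul0r //.
  by rewrite cv eq_sym.
apply: eq_bigl => I; apply: andb_idl => /forallP H.
apply/andP; split; first exact/forallP.
by apply/eqP/setP => v; rewrite inE (eqP (H (v, false))).
Qed.

(** With 1 as factors of the other colour, [Bpart_1] leaves only the full vertex set in
    [Bpart_split]. *)
Lemma Bpart_depends c k f g : separates c -> depends_on c f -> depends_on c g ->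
  Bpart pi_ predT k f g = Bpart pi_ c k f g.
Proof.
move=> sc cf cg; have d1 := @depends_on1 R N (predC c).
have := Bpart_split k sc cf d1 cg d1; rewrite !mulr1 => ->.
rewrite (bigD1 [set: 'I_k]) //= big1 ?addr0 => [|A nA].
  by rewrite Bpart_1 finset.setCT cards0 mulr1 cardsT card_ord.
rewrite Bpart_1; have [A0|] := eqVneq #|~: A| 0; last by rewrite mulr0.
by case/eqP: nA; rewrite -[A]finset.setCK (cards0_eq A0) finset.setC0.
Qed.

Lemma B_conv c k f1 f2 g1 g2 : separates c ->
  depends_on c f1 -> depends_on (predC c) f2 ->
  depends_on c g1 -> depends_on (predC c) g2 ->
  B pi_ k (f1 * f2) (g1 * g2) = \sum_(j < k.+1) B pi_ j f1 g1 * B pi_ (k - j) f2 g2.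
Proof.
move=> sc cf1 cf2 cg1 cg2; rewrite B_Bpart (Bpart_split k sc cf1 cf2 cg1 cg2).
rewrite (partition_big (fun A : {set 'I_k} => inord #|A| : 'I_k.+1) predT) //= scaler_sumr.
apply: eq_bigr => j _; rewrite !B_Bpart.
rewrite (Bpart_depends j sc cf1 cg1) (Bpart_depends (k - j) (separatesC sc) cf2 cg2).
have cardE (A : {set 'I_k}) : (inord #|A| == j) = (#|A| == j :> nat).
  by rewrite -val_eqE /= inordK // ltnS -[k in (_ <= k)%N]card_ord max_card.
rewrite (eq_bigl (fun A : {set 'I_k} => #|A| == j :> nat)) => [|A]; last by rewrite cardE.
rewrite (eq_bigr (fun _ => Bpart pi_ c j f1 g1 * Bpart pi_ (predC c) (k - j) f2 g2)); last first.
  move=> A /eqP Aj; have := cardsC A; rewrite Aj card_ord => Ak.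
  by congr (_ * Bpart _ _ _ _ _); rewrite -[LHS](addKn j) Ak.
(* The number of sets of size [j] turns [1 / k!] into [1 / (j! (k - j)!)], the factorials of the two
   factors. *)
rewrite sumr_const (_ : #|_| = 'C(k, j)); last by rewrite -cardsE card_draws card_ord.
have jk : (j <= k)%N by rewrite -ltnS.
rewrite -[RHS]scalerAl -[X in _ = _ *: X]scalerAr [RHS]scalerA.
rewrite -[X in _ *: X = _]scaler_nat [LHS]scalerA; congr (_ *: _).
rewrite -(bin_fact jk) !natrM !invfM.
have n0 m : m`!%:R != 0 :> R by rewrite pnatr_eq0 -lt0n fact_gt0.
have b0 : 'C(k, j)%:R != 0 :> R by rewrite pnatr_eq0 -lt0n bin_gt0.
by field; rewrite !n0 b0.
Qed.

Lemma B_1l k g : B pi_ k 1 g = if k is 0 then g else 0.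
Proof.
rewrite B_Bpart; case: k => [|k]; last by rewrite Bpart_1l // scaler0.
by rewrite Bpart0 mul1r fact0 invr1 scale1r.
Qed.

Lemma B_1r k f : B pi_ k f 1 = if k is 0 then f else 0.
Proof.
rewrite B_Bpart; case: k => [|k]; last by rewrite Bpart_1r // scaler0.
by rewrite Bpart0 mulr1 fact0 invr1 scale1r.
Qed.

End Convolution.

(** * Products of polynomials in separate points *)

Lemma subm_id N (m : 'X_{1..N}) : (m - m = 0)%MM.
Proof. by apply/mnmP => i; rewrite mnmBE subnn mnm0E. Qed.

(** The chain rule: it holds for constants and variables and passes to products and sums. *)
Lemma mderiv_comp (R : comNzRingType) (d N : nat) (lq : d.-tuple {mpoly R[N]})
    (f : {mpoly R[d]}) (l : 'I_N) :
  (f \mPo lq)^`M(l) = \sum_(j < d) (f^`M(j) \mPo lq) * (tnth lq j)^`M(l).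
Proof.
pose S f := (f \mPo lq)^`M(l) = \sum_(j < d) (f^`M(j) \mPo lq) * (tnth lq j)^`M(l).
have SC c : S c%:MP.
  rewrite /S comp_mpolyC mderivC big1 // => j _.
  by rewrite mderivC comp_mpoly0 mul0r.
have SM p q : S p -> S q -> S (p * q).
  rewrite /S => Sp Sq; rewrite rmorphM mderivM Sp Sq mulr_suml mulr_sumr -big_split /=.
  by apply: eq_bigr => j _; rewrite mderivM raddfD /= !rmorphM /=; ring.
have SX j : S 'X_j.
  rewrite /S comp_mpolyXU -tnth_nth (bigD1 j) //= big1 => [|i ij].
    by rewrite mderivX mnmE eqxx scale1r subm_id mpolyX0 comp_mpoly1 mul1r addr0.
  by rewrite mderivX mnmE eq_sym (negPf ij) scale0r comp_mpoly0 mul0r.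
elim/mpolyind: f => [|c m f _ _ IH]; first exact: (SC 0).
rewrite raddfD mderivD [X in _ + X = _]IH.
have -> : (c *: 'X_[m] \mPo lq)^`M(l) =
    \sum_(j < d) ((c *: 'X_[m])^`M(j) \mPo lq) * (tnth lq j)^`M(l).
  rewrite -mul_mpolyC mpolyXE_id; apply: (SM _ _ (SC c)).
  apply: (big_ind S) => [||i _]; [exact: (SC 1)|exact: SM|].
  by elim: (m i) => [|r IHr]; [exact: (SC 1)|rewrite exprS; exact: (SM)].
rewrite -big_split; apply: eq_bigr => j _.
by rewrite mderivD raddfD mulrDl.
Qed.

(** * The operators [B_k] of the product Poisson structure *)

Section Points.
Context (R : realType) (d n : nat) (pi_ : 'M[{mpoly R[d]}]_d).
Implicit Types (f g : {mpoly R[d]}).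

HB.instance Definition _ (i : 'I_n) := GRing.RMorphism.copy (@at_point R d n i)
  (comp_mpoly [tuple 'X_(mxvec_index i j) | j < d]).

Lemma at_pointZ i c f : at_point i (c *: f) = c *: at_point i f :> {mpoly R[n * d]}.
Proof. exact: comp_mpolyZ. Qed.

Lemma coord_pairK (l : 'I_(n * d)) :
  mxvec_index (coord_pair l).1 (coord_pair l).2 = l.
Proof. by case/mxvec_indexP: l => i j; rewrite mxvec_indexK. Qed.

Lemma mderiv_at_point i f l : (at_point i f : {mpoly R[n * d]})^`M(l) =
  if (coord_pair l).1 == i then at_point i f^`M((coord_pair l).2) else 0.
Proof.
rewrite /at_point mderiv_comp.
have E j : ('X_(mxvec_index i j) : {mpoly R[n * d]})^`M(l) = (mxvec_index i j == l)%:R.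
  rewrite mderivX mnmE; case: eqP => [<-|_]; last by rewrite scale0r.
  by rewrite scale1r subm_id mpolyX0.
under eq_bigr => j _ do rewrite tnth_mktuple E.
case: ifPn => [/eqP <-|li].
  rewrite (bigD1 (coord_pair l).2) //= coord_pairK eqxx mulr1 big1 ?addr0 // => j jl.
  case: eqP => [e|]; last by rewrite mulr0.
  by case/eqP: jl; rewrite -e mxvec_indexK.
rewrite big1 // => j _; case: eqP => [e|]; last by rewrite mulr0.
by move: li; rewrite -e mxvec_indexK eqxx.
Qed.

Definition points (s : seq 'I_n) : pred 'I_(n * d) := fun l => (coord_pair l).1 \in s.

Lemma depends_on_at_point s i f : i \in s -> depends_on (points s) (at_point i f).
Proof.
move=> si l; rewrite mderiv_at_point /points; case: eqP => // ->; by rewrite si.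
Qed.

Lemma depends_onM N (x : pred 'I_N) (f g : {mpoly R[N]}) :
  depends_on x f -> depends_on x g -> depends_on x (f * g).
Proof. by move=> xf xg l xl; rewrite mderivM xf // xg // mulr0 mul0r addr0. Qed.

Lemma separates_points s : separates (product_poisson n pi_) (points s).
Proof.
split => [i j ij|i j l _ li]; rewrite mxE.
  by rewrite ifN //; apply: contraNneq ij => e; rewrite /points e.
case: ifP => _; last by rewrite mderiv0.
rewrite mderiv_at_point ifN //; apply: contraNneq li => e.
by rewrite /points e.
Qed.

Lemma mderivm_at_point (T : finType) (I : T -> 'I_d) (P : pred T) i f :
  (at_point i f : {mpoly R[n * d]})^`M[(\sum_(e | P e) U_(mxvec_index i (I e)))%MM] =
  at_point i f^`M[(\sum_(e | P e) U_(I e))%MM].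
Proof.
elim: (index_enum T) f => [|e r IH] f; first by rewrite !big_nil !mderivm0m.
rewrite !big_cons; case: ifP => _ //.
by rewrite !mderivmDm !mderivmU1m mderiv_at_point mxvec_indexK eqxx IH.
Qed.

(** By [Bpart_depends] only labels at the point [i] count, and these correspond to labels in
    ['I_d]. *)
Lemma B_at_point i k f g :
  B (product_poisson n pi_) k (at_point i f) (at_point i g) = at_point i (B pi_ k f g).
Proof.
have ii : i \in [:: i] by rewrite mem_head.
rewrite !B_Bpart (Bpart_depends k (separates_points [:: i])
  (depends_on_at_point f ii) (depends_on_at_point g ii)).
rewrite [RHS]at_pointZ; congr (_ *: _); rewrite /Bpart raddf_sum; apply: eq_bigr => G _.
rewrite [RHS]at_pointZ; congr (_ *: _); rewrite raddf_sum.
pose hI (I : {ffun edge k -> 'I_d}) := [ffun e => mxvec_index i (I e)].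
rewrite (reindex_onto hI (fun I => [ffun e => (coord_pair (I e)).2])) /=; last first.
  move=> I /forallP cI; apply/ffunP => e; rewrite !ffunE.
  by have := cI e; rewrite /points inE => /eqP <-; rewrite coord_pairK.
apply: eq_big => [I|I _].
  rewrite [RHS](_ : _ = true); last by apply/forallP.
  apply/andP; split.
    by apply/forallP => e; rewrite ffunE /points mxvec_indexK inE.
  by apply/eqP/ffunP => e; rewrite !ffunE mxvec_indexK.
have dE w : diff_at G (hI I) w = (\sum_(e | G e == w) U_(mxvec_index i (I e)))%MM.
  by apply: eq_bigr => e _; rewrite ffunE.
rewrite /graph_term !rmorphM rmorph_prod /= !dE !mderivm_at_point.
congr (_ * _ * _); apply: eq_bigr => v _.
by rewrite dE !ffunE mxE !mxvec_indexK eqxx mderivm_at_point.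
Qed.

(** Peeling off one point at a time iterates [B_conv]; the iterated convolution is encoded as a
    product of generating polynomials, truncated at a degree beyond [m]. *)
Lemma B_prod_coef (s : seq 'I_n) (F G : 'I_n -> {mpoly R[d]}) M m :
  uniq s -> (m < M)%N ->
  B (product_poisson n pi_) m (\prod_(i <- s) at_point i (F i))
                              (\prod_(i <- s) at_point i (G i)) =
  (\prod_(i <- s) \poly_(k < M) at_point i (B pi_ k (F i) (G i)))`_m.
Proof.
elim: s m => [|i s IH] m.
  by rewrite !big_nil B_1l coef1; case: m.
rewrite /= => /andP[ins us] mM; rewrite !big_cons.
have dep (H : 'I_n -> {mpoly R[d]}) :
    depends_on (predC (points [:: i])) (\prod_(j <- s) at_point j (H j)).
  rewrite big_seq; apply: (big_ind (@depends_on R (n * d) _)).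
  - exact: depends_on1.
  - exact: depends_onM.
  - move=> j js l; rewrite /= negbK /points inE => /eqP li.
    by rewrite mderiv_at_point li; case: eqP => // e; rewrite e js in ins.
have ii : i \in [:: i] by rewrite mem_head.
rewrite (B_conv m (separates_points [:: i]) (depends_on_at_point _ ii) (dep _)
  (depends_on_at_point _ ii) (dep _)).
rewrite coefM; apply: eq_bigr => j _.
have jm : (j <= m)%N by rewrite -ltnS.
rewrite coef_poly (leq_ltn_trans jm mM) B_at_point IH //.
exact: leq_ltn_trans (leq_subr _ _) mM.
Qed.

Lemma B_prod (F G : 'I_n -> {mpoly R[d]}) m :
  B (product_poisson n pi_) m (\prod_i at_point i (F i)) (\prod_i at_point i (G i)) =
  \sum_(kappa : {ffun 'I_n -> 'I_m.+1} | (\sum_i kappa i)%N == m)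
    \prod_i at_point i (B pi_ (kappa i) (F i) (G i)).
Proof.
(* Exponents above [m] cannot enter the coefficient of degree [m], so they may be taken in
   ['I_m.+1]. *)
rewrite (B_prod_coef F G (M := m.+1)) ?index_enum_uniq //.
under eq_bigr => i _ do rewrite poly_def.
rewrite bigA_distr_bigA coef_sum [RHS]big_mkcond; apply: eq_bigr => ka _.
rewrite scaler_prod coefZ prodrXr coefXn eq_sym.
by case: ifP => _; rewrite ?mulr1 ?mulr0.
Qed.

End Points.

(** * Multi-symmetric functions *)

Section MultisymExpansion.
Context (R : realType) (d n : nat) (S : choiceType) (T : finType).
Variables (h : T -> option S) (t0 : T).
Hypotheses (h_inj : injective h) (h_t0 : h t0 = None).
Implicit Types (theta : {ffun 'I_n -> T}) (u : S -> {mpoly R[d]}).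

Definition option_monom (o : option S) : cmonom S :=
  if o is Some s then ucm s else mone.

(** The exponent of [t] when point [i] selects the term labelled [theta i]; the label sent to [None]
    selects the summand 1. *)
Definition type_of theta : cmonom S :=
  \big[mmul/mone]_i option_monom (h (theta i)).

Definition option_value u (o : option S) : {mpoly R[d]} :=
  if o is Some s then u s else 1.

Lemma type_ofE theta s : type_of theta s = (\sum_i (h (theta i) == Some s))%N.
Proof.
rewrite /type_of (big_morph (fun m : cmonom S => m s) (id1 := 0%N) (op1 := addn)).
- by apply: eq_bigr => i _; case: (h _) => [s'|] /=; rewrite ?cmU ?cm1.
- by move=> x y; rewrite cmM.
- exact: cm1.
Qed.

Lemma mem_type_of theta i s : h (theta i) = Some s -> (0 < type_of theta s)%N.
Proof. by move=> hs; rewrite type_ofE (bigD1 i) //= hs eqxx. Qed.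

Lemma type_of_gt0 theta s : (0 < type_of theta s)%N -> exists i, h (theta i) = Some s.
Proof.
rewrite type_ofE => s0.
have [/existsP[i /eqP hi]|/existsPn nh] := boolP [exists i, h (theta i) == Some s].
  by exists i.
by move: s0; rewrite big1 // => i _; rewrite (negPf (nh i)).
Qed.

(** Double counting of pairs of an index and a point carrying it. *)
Lemma sum_type_of theta (P : pred S) (w : S -> nat) :
  (\sum_(s <- finsupp (type_of theta) | P s) w s * type_of theta s =
   \sum_i (if h (theta i) is Some s then if P s then w s else 0 else 0))%N.
Proof.
under eq_bigr => s _ do rewrite type_ofE big_distrr /=.
rewrite exchange_big /=; apply: eq_bigr => i _.
case hi : (h (theta i)) => [s|]; last by rewrite big1 // => s _; rewrite muln0.
rewrite big_mkcond (bigD1_seq s) ?fset_uniq //=; last first.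
  by rewrite -cmE_neq0 -lt0n; exact: mem_type_of hi.
rewrite eqxx muln1 big1 ?addn0 // => s' ss'.
case: ifP => // _; case: eqP => [[e]|_]; last by rewrite muln0.
by rewrite e eqxx in ss'.
Qed.

Lemma mdeg_type_of theta : (monalg.mdeg (type_of theta) <= n)%N.
Proof.
rewrite monalg.mdegE; under eq_bigr do rewrite -[type_of _ _]mul1n.
rewrite (sum_type_of theta predT (fun=> 1%N)).
rewrite -[n in (_ <= n)%N]card_ord -sum1_card; apply: leq_sum => i _.
by case: (h _).
Qed.

(** Expansion of the defining product: each point selects 1 or some [u_s t_s]. *)
Lemma multisymE (delta : cmonom S) u :
  (forall s, (0 < delta s)%N -> exists t, h t = Some s) ->
  multisym n delta u =
  \sum_(theta : {ffun 'I_n -> T} | type_of theta == delta)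
    \prod_i at_point i (option_value u (h (theta i))).
Proof.
move=> h_supp.
(* The defining product only has the variables in the support of [delta], while [T] may provide more
   labels. *)
pose D t := if h t is Some s then s \in finsupp delta else true.
pose elt i t : malg (cmonom S) {mpoly R[n * d]} :=
  mkmalgU (option_monom (h t)) (at_point i (option_value u (h t))).
pose g s := odflt t0 [pick t | h t == Some s].
have gP s : s \in finsupp delta -> h (g s) = Some s.
  rewrite -cmE_neq0 -lt0n => /h_supp[t ht]; rewrite /g.
  by case: pickP => [t' /eqP|/(_ t)] //=; rewrite ht eqxx.
have factorE i : 1 + \sum_(s <- finsupp delta) mkmalgU (ucm s) (at_point i (u s)) =
    \sum_(t | D t) elt i t.
  rewrite (bigD1 t0) /=; last by rewrite /D h_t0.
  rewrite {1}/elt h_t0 /= rmorph1; congr (_ + _).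
  rewrite -[RHS]big_filter [RHS](perm_big [seq g s | s <- finsupp delta]) /=.
    rewrite [RHS]big_map; apply: eq_big_seq => s sd.
    by rewrite /elt (gP _ sd).
  rewrite perm_sym; apply: uniq_perm.
  - rewrite map_inj_in_uniq ?fset_uniq // => s s' sd s'd e.
    by have := gP _ sd; rewrite e gP // => -[].
  - by rewrite filter_uniq // index_enum_uniq.
  - move=> t; rewrite mem_filter mem_index_enum andbT.
    apply/mapP/andP => [[s sd ->]|[Dt tt0]].
      rewrite /D gP // sd; split => //.
      by apply/eqP => e; have := gP _ sd; rewrite e h_t0.
    move: Dt; rewrite /D; case ht : (h t) => [s|] sd.
      by exists s => //; apply: h_inj; rewrite gP.
    by case/eqP: tt0; apply: h_inj; rewrite h_t0.
rewrite /multisym (eq_bigr (fun i => \sum_(t | D t) elt i t)) => [|i _]; last exact: factorE.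
rewrite bigA_distr_big raddf_sum /=.
have prodE theta : \prod_i elt i (theta i) =
    mkmalgU (type_of theta) (\prod_i at_point i (option_value u (h (theta i)))).
  rewrite /type_of; elim: (index_enum _) => [|i r IH].
    by rewrite !big_nil; exact/esym/monalg.mpolyC1E.
  rewrite !big_cons.
  rewrite IH.
  exact: fgmulUU.
under eq_bigr => theta _ do rewrite prodE mcoeffU.
rewrite [RHS]big_mkcond [LHS]big_mkcond; apply: eq_bigr => theta _.
(* A labelling of type [delta] uses only labels satisfying [D], so the restriction is automatic. *)
case: eqP => [td|_]; last by rewrite mulr0n if_same.
rewrite mulr1n ifT //; apply/familyP => i; rewrite /D unfold_in.
case hi : (h (theta i)) => [s|] //.
by rewrite -cmE_neq0 -lt0n -td; exact: mem_type_of hi.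
Qed.

(** Only the finitely many types in [r] give a nonempty inner sum, so the sum over [Q] reduces to a
    finite list. *)
Lemma fsum_type_of (V : nmodType) (Q : set (cmonom S)) (X : {ffun 'I_n -> T} -> V) :
  \sum_(gamma \in Q) \sum_(theta | type_of theta == gamma) X theta =
  \sum_(theta | type_of theta \in Q) X theta.
Proof.
pose r := undup [seq type_of theta | theta : {ffun 'I_n -> T}].
have rP theta : type_of theta \in r by rewrite mem_undup map_f // mem_enum.
rewrite -[Q in LHS]set_mem_set -(bigfs _ (r := r)); first last.
- move=> gamma _ gr; rewrite big_pred0 // => theta.
  by apply: contraNF gr => /eqP <-.
- exact: undup_uniq.
rewrite (exchange_big_dep xpredT) //= [RHS]big_mkcond /=.
apply: eq_bigr => theta _.
rewrite big_mkcond (bigD1_seq (type_of theta)) ?undup_uniq //= eqxx andbT.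
rewrite big1 ?addr0 // => gamma gt.
by rewrite [_ == gamma]eq_sym (negPf gt) andbF.
Qed.

End MultisymExpansion.

(** * Additivity of the operators [B_k] in each argument *)

Section Bilinearity.
Context (R : realType) (N : nat) (pi_ : 'M[{mpoly R[N]}]_N).
Implicit Types (f g : {mpoly R[N]}).

Lemma BDl k g : {morph (B pi_ k)^~ g : f1 f2 / f1 + f2}.
Proof.
move=> f1 f2; rewrite /B -big_split; apply: eq_bigr => G _ /=.
rewrite -scalerDr; congr (_ *: _); rewrite /B_graph -big_split; apply: eq_bigr => I _ /=.
by rewrite mderivmD mulrDr mulrDl.
Qed.

Lemma BDr k f : {morph B pi_ k f : g1 g2 / g1 + g2}.
Proof.
move=> g1 g2; rewrite /B -big_split; apply: eq_bigr => G _ /=.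
rewrite -scalerDr; congr (_ *: _); rewrite /B_graph -big_split; apply: eq_bigr => I _ /=.
by rewrite mderivmD mulrDr.
Qed.

Lemma B0l k g : B pi_ k 0 g = 0.
Proof. by apply: (addrI (B pi_ k 0 g)); rewrite -BDl !addr0. Qed.

Lemma B0r k f : B pi_ k f 0 = 0.
Proof. by apply: (addrI (B pi_ k f 0)); rewrite -BDr !addr0. Qed.

Lemma star_hconst f g m : star pi_ (hconst f) (hconst g) m = B pi_ m f g.
Proof.
rewrite /star big_ord_recl [X in _ + X]big1 ?addr0 => [|i _].
  rewrite big_ord_recl [X in _ + X]big1 ?addr0 => [|j _]; last exact: B0r.
  by rewrite !subn0.
by apply: big1 => j _; exact: B0l.
Qed.

End Bilinearity.

Lemma unlift_ord0_inj a : injective (unlift (ord0 : 'I_a.+1)).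
Proof. by move=> i j; case: unliftP => [i'|] ->; case: unliftP => [j'|] -> // [->]. Qed.

(** * Counting labellings of the points by the indices in [Q] *)

Section Reindexing.
Context (R : realType) (d a b n m : nat) (pi_ : 'M[{mpoly R[d]}]_d).
Variables (p : 'I_a -> {mpoly R[d]}) (q : 'I_b -> {mpoly R[d]}).
Variables (alpha : cmonom 'I_a) (beta : cmonom 'I_b).
Local Notation T := ('I_a.+1 * 'I_b.+1 * 'I_m.+1)%type.
Local Notation index := ('I_a.+1 * 'I_b.+1 * nat)%type.

(** The label [(0, 0, 0)] marks a point that carries neither some [p_l] nor some [q_r] and
    contributes the factor 1. *)
Definition index_of (t : T) : option index :=
  if t == (ord0, ord0, ord0) then None else Some (t.1.1, t.1.2, t.2 : nat).

Lemma index_of_inj : injective index_of.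
Proof.
move=> s t; rewrite /index_of; case: eqP => [->|_]; case: eqP => [->|_] //.
by case: s t => [[l r] k] [[l' r'] k'] [-> -> /val_inj ->].
Qed.

Lemma index_of_Some t l r k : index_of t = Some (l, r, k) ->
  [/\ t.1.1 = l, t.1.2 = r, t.2 = k :> nat & t != (ord0, ord0, ord0)].
Proof. by rewrite /index_of; case: ifPn => // t0 [<- <- <-]. Qed.

(** With [gamma s > 0], [k] is at most the summand [k * gamma s] of the total [m], so ['I_m.+1]
    suffices for the third component. *)
Lemma Q_index (gamma : cmonom index) s :
  gamma \in Q alpha beta n m -> (0 < gamma s)%N -> exists t, index_of t = Some s.
Proof.
move=> /set_mem[[g0 _] [_ gm _ _]]; case: s => [[l r] k] gs.
have km : (k < m.+1)%N.
  rewrite ltnS -gm (bigD1_seq (l, r, k)) ?fset_uniq //=; last by rewrite -cmE_neq0 -lt0n.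
  by rewrite (leq_trans _ (leq_addr _ _)) // leq_pmulr.
exists (l, r, Ordinal km); rewrite /index_of; case: eqP => // -[l0 r0 k0].
by move: gs; rewrite l0 r0 g0.
Qed.

Local Notation labels :=
  ({ffun 'I_n -> 'I_a.+1} * {ffun 'I_n -> 'I_b.+1} * {ffun 'I_n -> 'I_m.+1})%type.

Definition join_labels (u : labels) : {ffun 'I_n -> T} :=
  [ffun i => (u.1.1 i, u.1.2 i, u.2 i)].

Lemma join_labels_bij : bijective join_labels.
Proof.
exists (fun t : {ffun 'I_n -> T} =>
  ([ffun i => (t i).1.1], [ffun i => (t i).1.2], [ffun i => (t i).2])).
  by move=> [[x y] z]; congr (_, _, _); apply/ffunP => i; rewrite !ffunE.
by move=> t; apply/ffunP => i; rewrite !ffunE; case: (t i) => [[]].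
Qed.

Local Notation typeT := (@type_of n index T index_of).

(* [B_k(1, g) = B_k(f, 1) = 0] for [k > 0] excludes the labellings that are not
   [proper]. *)
Definition proper (u : labels) : bool :=
  [forall i, (u.1.1 i == ord0) || (u.1.2 i == ord0) ==> (u.2 i == ord0)].

(** The row and column sums of the joint type are the fibre sizes of the two component labellings,
    and the bound on its size holds because there are [n] points. *)
Lemma type_in_Q (u : labels) :
  (typeT (join_labels u) \in Q alpha beta n m) =
  [&& proper u, type_of (unlift ord0) u.1.1 == alpha,
      type_of (unlift ord0) u.1.2 == beta & (\sum_i u.2 i)%N == m].
Proof.
pose t := join_labels u.
have tE i : t i = (u.1.1 i, u.1.2 i, u.2 i) by rewrite ffunE.
have [pu|npu] /= := boolP (proper u); last first.
  (* An improper label has [k > 0], hence is an index of positive multiplicity where [Q] requires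
     0. *)
  apply/negP => /set_mem[[_ g0] _]; case/forallPn: npu => i; rewrite negb_imply => /andP[lr k0].
  have ti : index_of (t i) = Some (u.1.1 i, u.1.2 i, u.2 i : nat).
    by rewrite /index_of tE !xpair_eqE (negPf k0) andbF.
  have := mem_type_of ti; rewrite g0 ?lt0n //.
  by case/orP: lr => /eqP ->; [left|right].
have kz i : (u.1.1 i == ord0) || (u.1.2 i == ord0) -> u.2 i = 0%N :> nat.
  by move=> lr; have /forallP/(_ i) := pu; rewrite lr => /eqP ->.
have sumk : (\sum_(s <- finsupp (typeT t)) s.2 * typeT t s = \sum_i u.2 i)%N.
  rewrite (sum_type_of index_of t predT (fun s => s.2)); apply: eq_bigr => i _.
  by rewrite /index_of tE; case: eqP => // -[_ _ ->].
have suml l : (\sum_(s <- finsupp (typeT t) | s.1.1 == lift ord0 l) typeT t s =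
    type_of (unlift ord0) u.1.1 l)%N.
  under eq_bigr => s _ do rewrite -[typeT t s]mul1n.
  rewrite (sum_type_of index_of t (fun s => s.1.1 == lift ord0 l) (fun=> 1%N)) type_ofE.
  apply: eq_bigr => i _; rewrite /index_of tE.
  case: eqP => [[-> _ _]|_] /=; first by rewrite unlift_none.
  case: unliftP => [j|] -> /=; last by [].
  by rewrite (inj_eq lift_inj) (inj_eq (@Some_inj _)); case: eqP.
have sumr r : (\sum_(s <- finsupp (typeT t) | s.1.2 == lift ord0 r) typeT t s =
    type_of (unlift ord0) u.1.2 r)%N.
  under eq_bigr => s _ do rewrite -[typeT t s]mul1n.
  rewrite (sum_type_of index_of t (fun s => s.1.2 == lift ord0 r) (fun=> 1%N)) type_ofE.
  apply: eq_bigr => i _; rewrite /index_of tE.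
  case: eqP => [[_ -> _]|_] /=; first by rewrite unlift_none.
  case: unliftP => [j|] -> /=; last by [].
  by rewrite (inj_eq lift_inj) (inj_eq (@Some_inj _)); case: eqP.
have absurd_index i l r k : index_of (t i) = Some (l, r, k) ->
    l = ord0 \/ r = ord0 -> k = 0%N.
  move=> /index_of_Some[]; rewrite tE /= => <- <- <- _ lr.
  by apply: kz; case: lr => ->; rewrite eqxx ?orbT.
apply/idP/and3P => [/set_mem[_ [_ hm ha hb]]|[/eqP ha /eqP hb /eqP hm]].
  split; last by rewrite -sumk hm.
    by apply/cmP => x; rewrite -ha suml.
  by apply/cmP => x; rewrite -hb sumr.
apply/mem_set; split; first split.
(* Properness forces [k = 0] at a label [(0, 0, k)], and [index_of] sends [(0, 0, 0)] to [None]. *)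
- move=> k; apply/eqP; rewrite -leqn0 leqNgt; apply/negP => /type_of_gt0[ i hi].
  have k0 := absurd_index _ _ _ _ hi (or_introl erefl).
  have [] := index_of_Some hi; rewrite tE /= => -> -> e /eqP[].
  by congr (_, _, _); apply: val_inj; rewrite /= e k0.
- move=> l r k lr k0; apply/eqP; rewrite -leqn0 leqNgt.
  by apply/negP => /type_of_gt0[i /absurd_index/(_ lr) k00]; rewrite k00 in k0.
split => //.
- exact: mdeg_type_of.
- by rewrite sumk.
- by move=> l; rewrite suml ha.
- by move=> r; rewrite sumr hb.
Qed.

Local Notation pE l := (option_value p (unlift ord0 l)).
Local Notation qE r := (option_value q (unlift ord0 r)).

(** A missing polynomial is the constant 1, and [B_0(p, 1) = p], [B_0(1, q) = q],
    [B_0(1, 1) = 1]. *)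
Lemma B_family_value (t : T) :
  (t.1.1 == ord0) || (t.1.2 == ord0) ==> (t.2 == ord0) ->
  option_value (B_family pi_ p q) (index_of t) = B pi_ t.2 (pE t.1.1) (qE t.1.2).
Proof.
case: t => [[l r] k] /=; rewrite /index_of /B_family.
case: (unliftP ord0 l) => [l'|] ->; case: (unliftP ord0 r) => [r'|] -> H.
- by rewrite xpair_eqE /= !liftK.
- by move: H; rewrite eqxx orbT => /eqP ->; rewrite xpair_eqE /= liftK unlift_none B_1r.
- by move: H; rewrite eqxx => /eqP ->; rewrite xpair_eqE /= liftK unlift_none B_1l.
- by move: H; rewrite eqxx => /eqP ->; rewrite eqxx B_1l.
Qed.

Lemma B_not_proper (u : labels) : ~~ proper u ->
  \prod_i (at_point i (B pi_ (u.2 i) (pE (u.1.1 i)) (qE (u.1.2 i))) : {mpoly R[n * d]}) = 0.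
Proof.
case/forallPn => i; rewrite negb_imply => /andP[lr k0].
rewrite (bigD1 i) //= [X in at_point _ X](_ : _ = 0) ?rmorph0 ?mul0r //.
case/orP: lr => /eqP ->; rewrite unlift_none /= ?B_1l ?B_1r.
  by case: (u.2 i) k0 => -[].
by case: (u.2 i) k0 => -[].
Qed.

End Reindexing.

(** * The product formula for the functions [e_alpha(p)] and [e_beta(q)] *)

Theorem theorem19 (R : realType) (d a b n : nat)
    (hd : (0 < d)%N) (ha : (0 < a)%N) (hb : (0 < b)%N) (hn : (0 < n)%N)
    (br : ('rV[R]_d -> R) -> ('rV[R]_d -> R) -> 'rV[R]_d -> R)
    (pi_ : 'M[{mpoly R[d]}]_d) (hbr : regular_poisson br pi_)
    (p : 'I_a -> {mpoly R[d]}) (q : 'I_b -> {mpoly R[d]})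
    (alpha : cmonom 'I_a) (beta : cmonom 'I_b)
    (halpha : (monalg.mdeg alpha <= n)%N) (hbeta : (monalg.mdeg beta <= n)%N) :
  star (product_poisson n pi_)
       (hconst (multisym n alpha p)) (hconst (multisym n beta q)) =
  (fun m => \sum_(gamma \in Q alpha beta n m)
              multisym n gamma (B_family pi_ p q)) :> hseries R (n * d).
Proof.
apply/funext => m; rewrite star_hconst.
have supp c (x : cmonom 'I_c) (s : 'I_c) :
    (0 < x s)%N -> exists t : 'I_c.+1, unlift ord0 t = Some s.
  by move=> _; exists (lift ord0 s); rewrite liftK.
rewrite (multisymE n (@unlift_ord0_inj a) (unlift_none _) p (@supp _ alpha)).
rewrite (multisymE n (@unlift_ord0_inj b) (unlift_none _) q (@supp _ beta)).
rewrite (eq_fsbigr (fun gamma => \sum_(theta : {ffun 'I_n -> 'I_a.+1 * 'I_b.+1 * 'I_m.+1} |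
    type_of (@index_of a b m) theta == gamma)
    \prod_i at_point i (option_value (B_family pi_ p q) (index_of (theta i))))); last first.
  move=> gamma gQ; apply: (multisymE n (@index_of_inj a b m) (t0 := (ord0, ord0, ord0))).
    by rewrite /index_of eqxx.
  by move=> s; exact: Q_index gQ.
rewrite fsum_type_of (reindex (@join_labels a b n m)) /=; last first.
  exact/onW_bij/join_labels_bij.
(* Biadditivity and [B_prod] turn the left side into a sum over two labellings and the exponents
   [kappa], the three components of [labels]. *)
rewrite (big_morph _ (BDl _ _ _) (B0l _ _ _)).
under eq_bigr => phi _ do rewrite (big_morph _ (BDr _ _ _) (B0r _ _ _)).
rewrite pair_big /=.
under eq_bigr => phi _ do rewrite B_prod.
rewrite pair_big /= [LHS]big_mkcond [RHS]big_mkcond /=; apply: eq_bigr => u _.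
(* An improper labelling contributes 0 on the left and has its type outside [Q] on the right. *)
rewrite type_in_Q; have [pu|npu] := boolP (proper u); last first.
  by rewrite /= B_not_proper // if_same.
rewrite /= andbA; case: ifP => // _; apply: eq_bigr => i _.
by rewrite ffunE B_family_value //; have /forallP/(_ i) := pu.
Qed.
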